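(* Let $A\in\mathbb{R}^{l\times m}$, $B\in\mathbb{R}^{n\times m}$ with $C=\ker A\cap\mathbb{R}^m_>\neq\emptyset$ and $d_P=d$, and let $P$, $v^1,\ldots,v^{n_P}$, $T$, $D$ and $F\colon\mathbb{R}^{d_P}\to\mathbb{R}^d_>$ be as defined in the context. The map $F$ is a diffeomorphism if and only if (i) there do not exist $y\in P$ and nonzero $t\in T$ and $\bar d\in D^\perp$ such that $t=y\circ\bar d$, and (ii) for every nonzero $t\in T$, \[ \mu^{\max}(t)\notin D^\perp, \] where $\mu^{\max}(t)\in\mathbb{R}^m$ has components \[ \mu_j^{\max}(t)=\max_{k\colon v_j^k\neq0}\,v^k\cdot t,\qquad j=1,\ldots,m . \]
   Context: Notation: $\mathbb{R}_>$ are the positive reals, $\mathbb{R}_\ge$ the nonnegative reals, $\circ$ is the componentwise product, $1_m\in\mathbb{R}^m$ is the all-ones vector. For $x\in\mathbb{R}^m_>$ and $y\in\mathbb{R}^m$, $x^y=\prod_i x_i^{y_i}$; for a matrix $Y=(y^1,\ldots,y^r)\in\mathbb{R}^{m\times r}$ with columns $y^j$, $x^Y\in\mathbb{R}^r_>$ has components $(x^Y)_j=x^{y^j}$. Coefficient polytope: $P=C\cap\Delta$ with $C=\ker A\cap\mathbb{R}^m_>$ (assumed nonempty) and $\Delta=\{y\in\mathbb{R}^m_\ge\mid 1_m\cdot y=1\}$; $d_P=\dim P$. $P$ is relatively open; its closure $\overline P$ is a polytope with vertices $v^1,\ldots,v^{n_P}\in\mathbb{R}^m$. Subspaces: $\mathcal{A}=\begin{pmatrix}A\\1_m^{\mathsf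 T}\end{pmatrix}$, $T=\ker\mathcal{A}$ (of dimension $d_P$), $T=\operatorname{im}G$ with $G\in\mathbb{R}^{m\times d_P}$ having orthonormal columns. $\mathcal{B}=\begin{pmatrix}B\\1_m^{\mathsf T}\end{pmatrix}$, $D=\ker\mathcal{B}$, $d=\dim D$, $D=\operatorname{im}H$ with basis matrix $H\in\mathbb{R}^{m\times d}$. Standing assumption: $d_P=d$. Parametrization $p\colon\mathbb{R}^{d_P}\to P$ (a real analytic isomorphism) and map $F$: \[ p(\xi)=\frac{\sum_{k=1}^{n_P}\mathrm{e}^{v^k\cdot G\xi}\,v^k}{\sum_{k=1}^{n_P}\mathrm{e}^{v^k\cdot G\xi}},\qquad F\colon\mathbb{R}^{d_P}\to\mathbb{R}^d_>,\quad F(\xi)=p(\xi)^H . \] Diffeomorphism means a bijective $C^1$ map with $C^1$ inverse. *)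

(* Defs.v *)
From HB Require Import structures.
From mathcomp Require Import all_boot all_order all_algebra.
From mathcomp Require Import all_classical all_reals all_analysis.

Set Implicit Arguments.
Unset Strict Implicit.
Unset Printing Implicit Defensive.

Import Order.TTheory GRing.Theory Num.Theory.
Import numFieldNormedType.Exports.

Local Open Scope classical_set_scope.
Local Open Scope ring_scope.

(* Vectors of R^m are column vectors 'cV[R]_m. *)

Definition dot (R : realType) (m : nat) (u v : 'cV[R]_m) : R :=
  \sum_(i < m) u i 0 * v i 0.

Definition cmul (R : realType) (m : nat) (u v : 'cV[R]_m) : 'cV[R]_m :=
  map2_mx *%R u v.

Definition posv (R : realType) (m : nat) : set 'cV[R]_m :=
  [set x : 'cV[R]_m | forall i, 0 < x i 0].

Definition kerv (R : realType) (k m : nat) (M : 'M[R]_(k, m)) :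
    {vspace 'cV[R]_m} :=
  lker (linfun (mulmx M : 'cV[R]_m -> 'cV[R]_k)).

Definition imv (R : realType) (m k : nat) (M : 'M[R]_(m, k)) :
    {vspace 'cV[R]_m} :=
  limg (linfun (mulmx M : 'cV[R]_k -> 'cV[R]_m)).

Definition orthv (R : realType) (m : nat) (U : {vspace 'cV[R]_m}) :
    set 'cV[R]_m :=
  [set w : 'cV[R]_m | forall u, u \in U -> dot w u = 0].

Definition coeff_cone (R : realType) (l m : nat) (A : 'M[R]_(l, m)) :
    set 'cV[R]_m :=
  [set x : 'cV[R]_m | x \in kerv A] `&` @posv R m.

Definition std_simplex (R : realType) (m : nat) : set 'cV[R]_m :=
  [set y : 'cV[R]_m | (forall i, 0 <= y i 0) /\ dot (const_mx 1) y = 1].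

Definition coeff_polytope (R : realType) (l m : nat) (A : 'M[R]_(l, m)) :
    set 'cV[R]_m :=
  coeff_cone A `&` @std_simplex R m.

Definition ker_ones (R : realType) (k m : nat) (M : 'M[R]_(k, m)) :
    {vspace 'cV[R]_m} :=
  kerv (col_mx M (const_mx 1 : 'rV[R]_m)).

(* S is nonempty of affine dimension k: the smallest linear subspace U such
   that S is contained in a translate x0 + U has dimension k. *)
Definition has_affine_dim (R : realType) (m : nat) (S : set 'cV[R]_m)
    (k : nat) : Prop :=
  exists (x0 : 'cV[R]_m) (U : {vspace 'cV[R]_m}),
    [/\ S x0, \dim U = k &
      forall W : {vspace 'cV[R]_m},
        (U <= W)%VS <-> (forall x, S x -> x - x0 \in W)].

Definition vertices (R : realType) (m : nat) (Q : set 'cV[R]_m) :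
    set 'cV[R]_m :=
  [set x : 'cV[R]_m | Q x /\
    forall (y z : 'cV[R]_m) (a : R), Q y -> Q z -> 0 < a < 1 ->
      x = a *: y + (1 - a) *: z -> y = x /\ z = x].

Definition monom (R : realType) (m r : nat) (x : 'cV[R]_m) (Y : 'M[R]_(m, r)) :
    'cV[R]_r :=
  \col_(j < r) \prod_(i < m) (x i 0) `^ (Y i j).

Definition param (R : realType) (m k n : nat) (v : 'I_n -> 'cV[R]_m)
    (G : 'M[R]_(m, k)) (xi : 'cV[R]_k) : 'cV[R]_m :=
  (\sum_(i < n) expR (dot (v i) (G *m xi)))^-1 *:
    \sum_(i < n) expR (dot (v i) (G *m xi)) *: v i.

Definition mapF (R : realType) (m k d n : nat) (v : 'I_n -> 'cV[R]_m)
    (G : 'M[R]_(m, k)) (H : 'M[R]_(m, d)) (xi : 'cV[R]_k) : 'cV[R]_d :=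
  monom (param v G xi) H.

(* The maximum is computed in \bar R, where the empty maximum is -oo. When the
   v k are the vertices of the closure of a nonempty set of positive vectors,
   the index set is nonempty for every j, so that fine is applied to a finite
   value. *)
Definition mu_max (R : realType) (m n : nat) (v : 'I_n -> 'cV[R]_m)
    (t : 'cV[R]_m) : 'cV[R]_m :=
  \col_(j < m) fine (\big[maxe/-oo%E]_(k < n | v k j 0 != 0) (dot (v k) t)%:E).

(* To be used with U open. In finite dimension, continuity of the differential
   x |-> 'd f x is continuity of x |-> 'd f x h for every direction h. *)
Definition C1_on (R : realType) (p q : nat) (U : set 'cV[R]_p)
    (f : 'cV[R]_p -> 'cV[R]_q) : Prop :=
  forall x, U x ->
    differentiable f x /\
    forall h : 'cV[R]_p, {for x, continuous (fun y => 'd f y h)}.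

Definition diffeomorphism (R : realType) (p q : nat)
    (U : set 'cV[R]_p) (V : set 'cV[R]_q) (f : 'cV[R]_p -> 'cV[R]_q) : Prop :=
  [/\ set_bij U V f, C1_on U f &
    exists g : 'cV[R]_q -> 'cV[R]_p,
      [/\ (forall x, U x -> g (f x) = x),
          (forall y, V y -> f (g y) = y) & C1_on V g]].

(* Main.v *)
Require Import Defs.
From HB Require Import structures.
From mathcomp Require Import all_boot all_order all_algebra.
From mathcomp Require Import all_classical all_reals all_analysis.
From mathcomp Require Import ring lra.

Set Implicit Arguments.
Unset Strict Implicit.
Unset Printing Implicit Defensive.

Import Order.TTheory GRing.Theory Num.Theory.
Import numFieldNormedType.Exports.

Local Open Scope classical_set_scope.
Local Open Scope ring_scope.

(** The columns of [H] span [ker_ones B], whose elements have coordinate sum 0.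
    Hence the normalizing factor of the parametrization drops out of [F], and
    [F] is the componentwise exponential of
    [logF xi = H^T ln (sum_k exp (v_k . G xi) v_k)].  As the exponential is a
    diffeomorphism onto the positive orthant, the question is when [logF] is a
    diffeomorphism of a Euclidean space onto itself.  By Hadamard's theorem
    ([global_inverse]) it suffices that the Jacobian of [logF] is everywhere
    invertible and that [logF] is proper.

    Condition (i) is invertibility of the Jacobian.  At [xi], with
    [y = param xi], a direction [h] moves the polytope point [y] by a tangent
    vector [t], and [logF] by [H^T (t / y)] ([JlogF_Dparam]); the quotient
    [t / y] is exactly the [db] of condition (i).  The map from [h] to [t] is
    a bijection onto [ker_ones A] ([Dparam_inj], [Dparam_surj]), because a
    weighted variance of the numbers [v_k . G h] vanishes only if all of them
    agree, and every [y] of the polytope is reached ([param_surj]).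

    Condition (ii) is properness.  A sum of exponentials is comparable to its
    largest term, so that [logF xi] stays within bounded distance of
    [H^T (mu_max (G xi))] ([logF_mu_max]).  The latter is continuous and
    positively homogeneous in [xi]: if it has no zero besides 0, then it grows
    linearly and [logF] is proper ([logF_proper]); if it vanishes at a nonzero
    [w], then [logF] is bounded along the ray of [w], and no continuous inverse
    of [F] can bring that unbounded ray back from a compact set.

    Hadamard's theorem is proved with a damped Newton step
    [S x = x - eta J(x)^-1 (f x - y)], which decreases [f - y] by a constant
    factor on sublevel sets once [eta] is small.  At a minimizer of [|f - y|]
    this forces [f x = y].  For injectivity, the points of a segment between two
    preimages of [y] are all driven close to preimages by iterating [S]; since
    preimages are isolated and [S] is continuous, the two end points cannot
    be different. *)

(** * Norm, continuity and compactness for matrices *)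

Section MatrixCalculus.
Variable R : realType.

Lemma ler_mx_entry (p q : nat) (M : 'M[R]_(p, q)) i j : `|M i j| <= `|M|.
Proof. by rewrite [leRHS]/Num.Def.normr/= mx_normrE (le_bigmax _ _ (i, j)). Qed.

Lemma mx_norm_le (p q : nat) (M : 'M[R]_(p, q)) (c : R) :
  0 <= c -> (forall i j, `|M i j| <= c) -> `|M| <= c.
Proof.
by move=> c0 Mc; rewrite [leLHS]/Num.Def.normr/= mx_normrE bigmax_le// => -[i j] _.
Qed.

Lemma mx_norm_mulmx (p q r : nat) (M : 'M[R]_(p, q)) (N : 'M[R]_(q, r)) :
  `|M *m N| <= q%:R * `|M| * `|N|.
Proof.
apply: mx_norm_le => [|i j]; first by rewrite !mulr_ge0.
rewrite mxE (le_trans (ler_norm_sum _ _ _))//.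
rewrite (@le_trans _ _ (\sum_(k < q) `|M| * `|N|))//.
  by apply: ler_sum => k _; rewrite normrM ler_pM// ler_mx_entry.
by rewrite sumr_const card_ord -mulrA mulr_natl.
Qed.

Lemma cvg_mxP (T : Type) (F : set_system T) (FF : Filter F) (p q : nat)
    (f : T -> 'M[R]_(p, q)) (M : 'M[R]_(p, q)) :
  f x @[x --> F] --> M <-> forall i j, f x i j @[x --> F] --> M i j.
Proof.
split=> [fM i j|fM].
  exact: (cvg_comp _ _ fM (@coord_continuous _ _ _ i j M)).
apply/cvgrPdist_le => e e0; near=> x.
apply: mx_norm_le => [|i j]; first exact: ltW.
rewrite !mxE; move: i j; near: x.
apply: filter_forall => i; apply: filter_forall => j.
exact: ((cvgrPdist_le _ _).1 (fM i j)).
Unshelve. all: by end_near. Qed.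

Lemma continuous_mxP (T : topologicalType) (p q : nat)
    (f : T -> 'M[R]_(p, q)) (x : T) :
  {for x, continuous f} <-> forall i j, {for x, continuous (fun y => f y i j)}.
Proof. exact: cvg_mxP. Qed.

Lemma continuous_mulmx (T : topologicalType) (p q r : nat)
    (f : T -> 'M[R]_(p, q)) (g : T -> 'M[R]_(q, r)) (x : T) :
  {for x, continuous f} -> {for x, continuous g} ->
  {for x, continuous (fun y => f y *m g y)}.
Proof.
move=> /continuous_mxP cf /continuous_mxP cg; apply/continuous_mxP => i j.
rewrite (_ : (fun y => _) = (fun y => \sum_k f y i k * g y k j)); last first.
  by apply/funext => y; rewrite mxE.
rewrite /prop_for /continuous_at.
apply: (cvg_big (@add_continuous R)) => k _.
exact: (cvgM (cf i k) (cg k j)).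
Qed.

Lemma continuous_det (T : topologicalType) (p : nat) (f : T -> 'M[R]_p) (x : T) :
  {for x, continuous f} -> {for x, continuous (fun y => \det (f y))}.
Proof.
move=> /continuous_mxP cf.
rewrite /determinant /prop_for /continuous_at.
apply: (cvg_big (@add_continuous R)) => s _; apply: cvgM; first exact: cvg_cst.
apply: (cvg_big (@mul_continuous R)) => i _; exact: cf.
Qed.

(** Cramer's rule turns the entries of the inverse into quotients of determinants. *)
Lemma continuous_invmx (T : topologicalType) (p : nat) (f : T -> 'M[R]_p) (x : T) :
  (forall y, f y \in unitmx) -> {for x, continuous f} ->
  {for x, continuous (fun y => invmx (f y))}.
Proof.
move=> fu cf; apply/continuous_mxP => i j.
rewrite (_ : (fun y => _) = (fun y => (\det (f y))^-1 * cofactor (f y) j i)); last first.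
  by apply/funext => y; rewrite /invmx fu !mxE.
have d0 : \det (f x) != 0 by have := fu x; rewrite unitmxE unitfE.
rewrite /prop_for /continuous_at; apply: cvgM.
  by apply: cvgV => //; exact: continuous_det.
rewrite /cofactor; apply: cvgM; first exact: cvg_cst.
apply: (@continuous_det _ _ (fun y => row' j (col' i (f y)))).
apply/continuous_mxP => k l.
rewrite (_ : (fun y => _) = (fun y => f y (lift j k) (lift i l))).
  by move/continuous_mxP : cf; exact.
by apply/funext => y; rewrite !mxE.
Qed.

(** The Heine-Borel theorem for row vectors, transported by transposition. *)
Lemma compact_cball (p : nat) (r : R) : compact [set x : 'cV[R]_p | `|x| <= r].
Proof.
have -> : [set x : 'cV[R]_p | `|x| <= r] = trmx @` [set x : 'rV[R]_p | `|x| <= r].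
  apply/seteqP; split => [x xr|_ [x xr <-]] /=.
    exists x^T; rewrite ?trmxK//=; apply: le_trans xr.
    by apply: mx_norm_le => // i j; rewrite mxE ler_mx_entry.
  apply: le_trans xr.
  by apply: mx_norm_le => // i j; rewrite mxE ler_mx_entry.
apply: continuous_compact.
  apply: continuous_subspaceT => x; apply/continuous_mxP => i j.
  rewrite (_ : (fun y => _) = (fun y : 'rV[R]_p => y j i)).
    exact: coord_continuous.
  by apply/funext => y; rewrite mxE.
apply: bounded_closed_compact.
  exists r; split; first exact: num_real.
  by move=> s rs x /= /le_trans; apply; exact: ltW.
apply: (@closed_comp _ _ (fun x : 'rV[R]_p => `|x|) [set y | y <= r]).
  by move=> x _; exact: norm_continuous.
exact: closed_le.
Qed.

Lemma closed_fun_le (p : nat) (f : 'cV[R]_p -> R) (r : R) :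
  continuous f -> closed [set x | f x <= r].
Proof.
move=> cf; apply: (@closed_comp _ _ f [set y | y <= r]) => [x _|].
  exact: cf.
exact: closed_le.
Qed.

Lemma coercive_min (p : nat) (f : 'cV[R]_p -> R) (x0 : 'cV[R]_p) (r : R) :
  continuous f -> (forall x, f x <= f x0 -> `|x| <= r) ->
  exists x, forall y, f x <= f y.
Proof.
move=> cf fr.
have x0r : `|x0| <= r by exact: fr.
have [||x _ xm] := @compact_EVT_min _ _ f _ _ (@compact_cball p r).
- by exists x0.
- exact: continuous_subspaceT.
exists x => y; have [yx0|/ltW] := leP (f y) (f x0).
  by apply: xm; rewrite inE; exact: fr.
by apply: le_trans; apply: xm; rewrite inE.
Qed.

Lemma continuous_sub (T : topologicalType) (V : normedModType R) (f g : T -> V) :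
  continuous f -> continuous g -> continuous (fun x => f x - g x).
Proof. by move=> cf cg x; apply: (@continuousB R V T f g x); [exact: cf|exact: cg]. Qed.

Lemma continuous_scale (T : topologicalType) (V : normedModType R) (k : R) (f : T -> V) :
  continuous f -> continuous (fun x => k *: f x).
Proof. by move=> cf x; apply: (@continuousZl_tmp R V T f k x); exact: cf. Qed.

Lemma continuous_normr (T : topologicalType) (V : normedModType R) (f : T -> V) :
  continuous f -> continuous (fun x => `|f x|).
Proof.
move=> cf x; apply: (@continuous_comp _ _ _ f (fun y => `|y|)); first exact: cf.
exact: norm_continuous.
Qed.

Lemma continuous_funcomp (T U V : topologicalType) (f : T -> U) (g : U -> V) :
  continuous f -> continuous g -> continuous (fun x => g (f x)).
Proof. by move=> cf cg x; apply: (@continuous_comp _ _ _ f g); [exact: cf|exact: cg]. Qed.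

Lemma continuous_idfun (T : topologicalType) : continuous (fun x : T => x).
Proof. by move=> x; exact: cvg_id. Qed.

Lemma continuous_segment (V : normedModType R) (a u : V) :
  continuous (fun s : R => a + s *: u).
Proof.
move=> s; apply: (@continuousD R V R (fun=> a) (fun s => s *: u) s).
  exact: cst_continuous.
exact: scalel_continuous.
Qed.

Lemma near_dist (V : normedModType R) (x : V) (e : R) :
  0 < e -> \forall y \near x, `|x - y| < e.
Proof. by move=> e0; apply/nbhs_ballP; exists e => // y; rewrite -ball_normE. Qed.

Lemma continuous_near_dist (T : topologicalType) (V : normedModType R)
    (f : T -> V) (x : T) (e : R) :
  {for x, continuous f} -> 0 < e -> \forall y \near x, `|f x - f y| < e.
Proof. by move=> cf e0; exact: (cf _ (near_dist (f x) e0)). Qed.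

Lemma continuous_dist (T : topologicalType) (V : normedModType R)
    (f : T -> V) (x : T) :
  (forall e, 0 < e -> \forall y \near x, `|f x - f y| < e) -> {for x, continuous f}.
Proof. by move=> fx; apply/cvgrPdist_lt => e e0; exact: fx. Qed.

End MatrixCalculus.

(** * Maps with a continuous Jacobian matrix *)

Section Differentials.
Variable R : realType.

(** Epsilon form of differentiability: the little-o of [is_diff] becomes a bound
    that can be combined by the triangle inequality. *)
Lemma is_diff_approx (V W : normedModType R) (f df : V -> W) (x : V) :
  linear df -> continuous df ->
  is_diff x f df <->
  forall e, 0 < e -> \forall y \near x, `|f y - f x - df (y - x)| <= e * `|y - x|.
Proof.
move=> ldf cdf.
pose L : {linear V -> W} := HB.pack df (GRing.isLinear.Build _ _ _ _ df ldf).
split=> [[[[_ /eqaddoP fE]] dE] e e0|approx].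
  move: fE => /(_ _ e0); apply: filterS => y.
  by rewrite dE lim_id// !fctE opprD addrA.
have loc : f \o shift x = cst (f x) + L +o_ 0 id.
  apply/eqaddoP => e e0.
  have := approx _ e0; rewrite (near_shift 0 x) /=; apply: filterS => y /=.
  rewrite subr0 addrK => fy.
  by rewrite !fctE opprD addrA.
split; last exact: (@diff_unique _ _ _ _ L).
apply/diff_locallyP; rewrite (@diff_unique _ _ _ _ L)//.
Qed.

Lemma mulmx_continuous (p q r : nat) (A : 'M[R]_(q, p)) :
  continuous (mulmx A : 'M[R]_(p, r) -> 'M[R]_(q, r)).
Proof.
move=> x; apply: (@continuous_mulmx _ 'M[R]_(p, r) _ _ _ (fun=> A) (fun y => y)).
  exact: cst_continuous.
exact: cvg_id.
Qed.

Lemma is_diff_mulmx (p q : nat) (f : 'cV[R]_p -> 'cV[R]_q) (A : 'M[R]_(q, p))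
    (x : 'cV[R]_p) :
  is_diff x f (mulmx A) <->
  forall e, 0 < e ->
    \forall y \near x, `|f y - f x - A *m (y - x)| <= e * `|y - x|.
Proof.
apply: is_diff_approx; last exact: mulmx_continuous.
by move=> a u v; rewrite mulmxDr -scalemxAr.
Qed.

(** Continuous differentiability with the derivative named as a matrix, so that
    the chain rule becomes a matrix product and the inverse derivative becomes
    [invmx]. *)
Definition C1_with (p q : nat) (U : set 'cV[R]_p) (f : 'cV[R]_p -> 'cV[R]_q)
    (J : 'cV[R]_p -> 'M[R]_(q, p)) : Prop :=
  forall x, U x -> is_diff x f (mulmx (J x)) /\ {for x, continuous J}.

Lemma C1_with_continuous (p q : nat) U (f : 'cV[R]_p -> 'cV[R]_q) J x :
  C1_with U f J -> U x -> {for x, continuous f}.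
Proof. by move=> fJ /fJ[[df _] _]; exact: differentiable_continuous. Qed.

Lemma C1_with_C1_on (p q : nat) U (f : 'cV[R]_p -> 'cV[R]_q) J :
  open U -> C1_with U f J -> C1_on U f.
Proof.
move=> oU fJ x Ux; have [[df dE] cJ] := fJ x Ux; split=> // h.
have cJh : {for x, continuous (fun y => J y *m h)}.
  by apply: continuous_mulmx => //; exact: cst_continuous.
have dEh y : U y -> 'd f y h = J y *m h by move=> /fJ[[_ e] _]; exact: (congr1 (@^~ h) e).
apply: (eq_ind_r (fun z => (fun y => 'd f y h) @ x --> z) _ (dEh x Ux)).
have Ux' : nbhs x U by exact: open_nbhs_nbhs.
apply: (@cvg_trans _ ((fun y => J y *m h) @ x) _ _ _ cJh).
apply: (@near_eq_cvg _ _ (nbhs x) _ (fun y => J y *m h) (fun y => 'd f y h)).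
near=> y; apply/esym/dEh; near: y; exact: Ux'.
Unshelve. all: by end_near. Qed.

Lemma C1_with_comp (p q r : nat) U V (f : 'cV[R]_p -> 'cV[R]_q) J
    (g : 'cV[R]_q -> 'cV[R]_r) K :
  C1_with U f J -> C1_with V g K -> (forall x, U x -> V (f x)) ->
  C1_with U (g \o f) (fun x => K (f x) *m J x).
Proof.
move=> fJ gK UV x Ux; have [df cJ] := fJ x Ux; have [dg cK] := gK _ (UV _ Ux).
split.
  apply: (@is_diff_eq _ _ _ _ _ _ _ (is_diff_comp df dg)).
  by apply/funext => h; rewrite /= mulmxA.
apply: continuous_mulmx => //.
by apply: continuous_comp => //; exact: (C1_with_continuous fJ).
Qed.

Lemma C1_with_mulmx (p q : nat) U (A : 'M[R]_(q, p)) :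
  C1_with U (mulmx A : 'cV[R]_p -> 'cV[R]_q) (cst A).
Proof.
move=> x _; split; last exact: cst_continuous.
apply/is_diff_mulmx => e e0; near=> y.
by rewrite mulmxBr subrr normr0 mulr_ge0// ltW.
Unshelve. all: by end_near. Qed.

Lemma C1_with_map (p : nat) (D : set R) (phi phi' : R -> R) :
  (forall t, D t -> is_derive t 1 phi (phi' t) /\ {for t, continuous phi'}) ->
  C1_with [set x : 'cV[R]_p | forall i, D (x i 0)] (map_mx phi)
    (fun x => diag_mx (map_mx phi' x)^T).
Proof.
move=> phiD x Dx; split; last first.
  apply/continuous_mxP => i j.
  rewrite (_ : (fun y => _) = (fun y : 'cV[R]_p => phi' (y i 0) *+ (i == j))); last first.
    by apply/funext => y; rewrite !mxE.
  case: (i == j); last exact: (@cst_continuous _ _ (0 : R)).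
  exact: (cvg_comp _ _ (@coord_continuous _ _ _ i 0 x) (phiD _ (Dx i)).2).
apply/is_diff_mulmx => e e0; near=> y.
apply: mx_norm_le => [|i j]; first by rewrite mulr_ge0// ltW.
rewrite ord1 mul_diag_mx !mxE.
apply: (@le_trans _ _ (e * `|y i 0 - x i 0|)); last first.
  rewrite ler_pM2l//; have := ler_mx_entry (y - x) i 0; by rewrite !mxE.
move: i {j}; near: y; apply: filter_forall => i.
have [d _] := phiD _ (Dx i).
have dphi : is_diff (x i 0) phi (fun h => h *: phi' (x i 0)).
  split; first by apply/derivable1_diffP; exact: ex_derive.
  by rewrite deriv1E// derive1E derive_val.
have lin : linear (fun h : R => h *: phi' (x i 0)).
  by move=> a u v; rewrite scalerDl scalerA.
have /(is_diff_approx _ _ lin) : continuous (fun h : R => h *: phi' (x i 0)).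
  by move=> h; exact: scalel_continuous.
move=> /(_ phi (x i 0))[/(_ dphi)/(_ _ e0) + _].
move=> /(@coord_continuous _ _ _ i 0 x) near_e.
near=> y; rewrite [phi' _ * _]mulrC; near: y; exact: near_e.
Unshelve. all: by end_near. Qed.

Lemma C1_with_expR (p : nat) :
  C1_with setT (map_mx expR : 'cV[R]_p -> 'cV[R]_p)
    (fun x => diag_mx (map_mx expR x)^T).
Proof.
have := @C1_with_map p setT expR expR.
rewrite (_ : [set x : 'cV[R]_p | _] = setT); last by apply/seteqP; split.
by apply => t _; split; [exact: is_derive_expR|exact: continuous_expR].
Qed.

Lemma C1_with_ln (p : nat) :
  C1_with (@posv R p) (map_mx (@ln R)) (fun x => diag_mx (map_mx GRing.inv x)^T).
Proof.
refine (@C1_with_map p [set t | 0 < t] (@ln R) GRing.inv _) => t /= t0.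
by split; [exact: is_derive1_ln|apply: inv_continuous; rewrite gt_eqF].
Qed.

End Differentials.

(** * Mean value theorem and uniform strict differentiability *)

Section Strict.
Variable R : realType.

Lemma C1_with_line (p q : nat) (f : 'cV[R]_p -> 'cV[R]_q) J
    (x u : 'cV[R]_p) (i : 'I_q) (s : R) :
  C1_with setT f J ->
  is_derive s 1 (fun t : R => f (x + t *: u) i 0) ((J (x + s *: u) *m u) i 0).
Proof.
move=> fJ; set d := (_ *m _) i 0.
have lin : linear (fun h : R => h *: d).
  by move=> a v w; rewrite scalerDl scalerA.
have cd : continuous (fun h : R => h *: d) by move=> h; exact: scalel_continuous.
have dg : is_diff s (fun t : R => f (x + t *: u) i 0) (fun h : R => h *: d).
  apply/(is_diff_approx _ _ lin cd) => e e0.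
  have [df _] := fJ (x + s *: u) I.
  have u0 : 0 < `|u| + 1 by rewrite ltr_wpDl.
  have := (is_diff_mulmx _ _ _).1 df (e / (`|u| + 1)) (divr_gt0 e0 u0).
  have cl : (fun t : R => x + t *: u) t @[t --> s] --> x + s *: u.
    by apply: cvgD; [exact: cvg_cst|exact: scalel_continuous].
  move=> /cl near_e; near=> t.
  have : `|f (x + t *: u) - f (x + s *: u)
      - J (x + s *: u) *m (x + t *: u - (x + s *: u))|
      <= e / (`|u| + 1) * `|x + t *: u - (x + s *: u)|.
    by near: t; exact: near_e.
  rewrite opprD addrACA subrr add0r -scalerBl -scalemxAr => h.
  apply: (le_trans (le_trans _ (le_trans (ler_mx_entry _ i 0) h))).
    by rewrite /d !mxE.
  rewrite normrZ mulrACA ler_piMr//; first by rewrite mulr_ge0// ltW.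
  by rewrite mulrC ler_pdivrMr// mul1r lerDl.
split; first by apply/derivable1_diffP; exact: ex_diff.
by rewrite deriveE; [rewrite diff_val scale1r|exact: ex_diff].
Unshelve. all: by end_near. Qed.

(** Fermat's rule, read along the line through [x] in direction [u]. *)
Lemma C1_with_min (p q : nat) (f : 'cV[R]_p -> 'cV[R]_q) J
    (x u : 'cV[R]_p) (i : 'I_q) :
  C1_with setT f J -> (forall y, f x i 0 <= f y i 0) -> (J x *m u) i 0 = 0.
Proof.
move=> fJ fmin.
have dg s := C1_with_line x u i s fJ.
have [_ g0] : is_derive (0 : R) 1 (fun t : R => f (x + t *: u) i 0) 0.
  apply: (@derive1_at_min _ _ (-1) 1 0); first by lra.
  - by move=> s _; exact: ex_derive.
  - by rewrite in_itv/= ltrN10 ltr01.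
  - by move=> s _; rewrite scale0r addr0; exact: fmin.
by have [_] := dg 0; rewrite g0 scale0r addr0.
Qed.

Lemma C1_with_mvt (p q : nat) (f : 'cV[R]_p -> 'cV[R]_q) J
    (x u : 'cV[R]_p) (i : 'I_q) :
  C1_with setT f J ->
  exists2 s : R, 0 <= s <= 1 &
    f (x + u) i 0 - f x i 0 = (J (x + s *: u) *m u) i 0.
Proof.
move=> fJ; have dg s := C1_with_line x u i s fJ.
have cg : {within `[0, 1], continuous (fun t : R => f (x + t *: u) i 0)}.
  apply: continuous_subspaceT => s.
  by apply/differentiable_continuous/derivable1_diffP; exact: ex_derive.
have [s] := MVT_segment ler01 (fun s _ => dg s) cg.
rewrite in_itv/= => s01 /=.
by rewrite scale1r scale0r addr0 subr0 mulr1 => ->; exists s.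
Qed.

(** The point of this bound is its uniformity in [x]: near a fixed point it follows
    from the mean value theorem and the continuity of [J], and compactness of the
    ball yields one radius [d] for all of its points. *)
Lemma C1_with_strict (p q : nat) (f : 'cV[R]_p -> 'cV[R]_q) J r e :
  C1_with setT f J -> 0 < e ->
  exists2 d, 0 < d & forall x u, `|x| <= r -> `|u| < d ->
    `|f (x + u) - f x - J x *m u| <= e * `|u|.
Proof.
move=> fJ e0.
have /compact_near_coveringP := @compact_cball R p r.
move=> /(_ R (0 : R)^'+ (fun d x => forall u, `|u| < d ->
    `|f (x + u) - f x - J x *m u| <= e * `|u|) _) cover.
suff /cover [d /= d0 dP] : forall x, [set x : 'cV[R]_p | `|x| <= r] x ->
    \forall x' \near x & d \near (0 : R)^'+, forall u, `|u| < d ->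
      `|f (x' + u) - f x' - J x' *m u| <= e * `|u|.
  exists (d / 2); first by rewrite divr_gt0.
  move=> x u xr ud; apply: (dP (d / 2)) => //=.
    by rewrite sub0r normrN gtr0_norm ?divr_gt0// ltr_pdivrMr// mulr_natr mulr2n ltrDl.
  by rewrite divr_gt0.
move=> x _; have [_ /cvgrPdist_le cJ] := fJ x I.
(* p * (2 * e1) <= e, with p the loss in the norm of a matrix product and 2 * e1
   the oscillation of J; the successor keeps the denominator positive. *)
pose e1 := e / (p.+1%:R * 2).
have e10 : 0 < e1 by rewrite divr_gt0// mulr_gt0.
have /nbhs_ballP[rho /= rho0 rhoP] := cJ _ e10.
exists (ball x (rho / 2), [set d | d < rho / 2]).
  split => /=; first by apply: nbhsx_ballx; rewrite divr_gt0.
  by apply: nbhs_right_lt; rewrite divr_gt0.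
move=> [x' d] /= [xx' drho] u ud.
have Jclose z : ball x rho z -> `|J z - J x'| <= 2 * e1.
  move=> xz.
  have h1 := rhoP z xz.
  have h2 : `|J x - J x'| <= e1.
    apply: rhoP; move: xx'; rewrite -!ball_normE /= => /lt_le_trans; apply.
    by move: rho0; lra.
  rewrite -(subrKA (J x)) (le_trans (ler_normD _ _))//.
  by rewrite mulr_natl mulr2n lerD// distrC.
apply: mx_norm_le => [|i j]; first by rewrite mulr_ge0// ltW.
rewrite ord1 {j}.
have [s /andP[s0 s1] fs] := C1_with_mvt x' u i fJ.
have -> : (f (x' + u) - f x' - J x' *m u) i 0 = ((J (x' + s *: u) - J x') *m u) i 0.
  rewrite mulmxBl; move: fs; move: (J (x' + _) *m u) (J x' *m u) => a b fs.
  by rewrite !mxE fs.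
apply: (le_trans (ler_mx_entry _ _ _)); apply: (le_trans (mx_norm_mulmx _ _)).
rewrite ler_wpM2r//.
apply: (@le_trans _ _ (p%:R * (2 * e1))).
  rewrite ler_wpM2l//; apply: Jclose.
  move: xx'; rewrite -!ball_normE /= => xx'.
  rewrite opprD addrA (le_lt_trans (ler_normB _ _))//.
  rewrite (splitr rho) ltrD// normrZ ger0_norm//.
  by rewrite (le_lt_trans _ (lt_trans ud drho))// ler_piMl.
have -> : p%:R * (2 * e1) = e * (p%:R / p.+1%:R).
  by rewrite /e1; field; rewrite nat1r pnatr_eq0.
by rewrite ler_piMr ?ltW// ltr_pdivrMr// mul1r ltr_nat.
Qed.

End Strict.

(** * Hadamard's global inversion theorem *)

Section GlobalInversion.
Variables (R : realType) (n : nat) (f : 'cV[R]_n -> 'cV[R]_n)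
  (J : 'cV[R]_n -> 'M[R]_n).
Hypothesis fJ : C1_with setT f J.
Hypothesis Junit : forall x, J x \in unitmx.
Hypothesis fproper : forall M : R, exists r, forall x, `|f x| <= M -> `|x| <= r.

Let cf : continuous f.
Proof. by move=> x; exact: (C1_with_continuous fJ). Qed.

Let cJi : continuous (fun x => invmx (J x)).
Proof.
by move=> x; apply: (@continuous_invmx R _ n J x) => //; have [] := fJ (I : setT x).
Qed.

Let cfB y : continuous (fun x => f x - y).
Proof. by apply: continuous_sub => //; exact: cst_continuous. Qed.

Lemma invmx_jacobian_bounded (r : R) : exists2 C, 0 < C &
  forall x w : 'cV[R]_n, `|x| <= r -> `|invmx (J x) *m w| <= C * `|w|.
Proof.
have [r0|r0] := ltP r 0.
  by exists 1 => // x w /le_lt_trans/(_ r0); rewrite normr_lt0.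
have [||c _ cmax] := @compact_EVT_max _ _ (fun x => `|invmx (J x)|) _ _
    (@compact_cball R n r).
- by exists 0; rewrite /= normr0.
- by apply: continuous_subspaceT; exact: continuous_normr.
exists (n%:R * `|invmx (J c)| + 1).
  by rewrite ltr_wpDl// mulr_ge0.
move=> x w xr; apply: (le_trans (mx_norm_mulmx _ _)).
rewrite ler_wpM2r// ler_wpDr// ler_wpM2l//.
by apply: cmax; rewrite inE.
Qed.

(** An invertible differential bounds [u] by the increment of [f]; in particular
    preimages of a given point are isolated, uniformly on balls, and the inverse
    of [f] is locally Lipschitz. *)
Lemma C1_with_expanding (r : R) : exists d C, [/\ 0 < d, 0 < C &
  forall a u : 'cV[R]_n, `|a| <= r -> `|u| < d -> `|u| <= C * `|f (a + u) - f a|].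
Proof.
have [C C0 CP] := invmx_jacobian_bounded r.
have e0 : 0 < (2 * C)^-1 by rewrite invr_gt0 mulr_gt0.
have [d d0 dP] := C1_with_strict r fJ e0.
exists d, (2 * C); split; [by []|by rewrite mulr_gt0|] => a u ar ud.
have h1 := dP a u ar ud.
have h2 := CP a (J a *m u) ar; rewrite mulKmx// in h2.
have h3 : `|J a *m u| <= `|f (a + u) - f a| + (2 * C)^-1 * `|u|.
  rewrite -[J a *m u](subKr (f (a + u) - f a)).
  by rewrite (le_trans (ler_normB _ _))// lerD2l.
have h4 : C * `|J a *m u| <= C * `|f (a + u) - f a| + `|u| / 2.
  rewrite (le_trans (ler_wpM2l (ltW C0) h3))// mulrDr lerD2l.
  have -> : C * ((2 * C)^-1 * `|u|) = `|u| / 2 by field; rewrite gt_eqF.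
  exact: lexx.
by rewrite -mulrA; move: (le_trans h2 h4); lra.
Qed.

(** Were [f] affine, the step [x - eta J(x)^-1 (f x - y)] would multiply [f x - y]
    by [1 - eta].  For [eta] small, uniformly on a sublevel set of
    [f - y], which is bounded by properness, the linearization error is at most
    [eta / 2] of [f x - y]. *)
Lemma damped_newton (y : 'cV[R]_n) (M : R) :
  exists (S : 'cV[R]_n -> 'cV[R]_n) (rho : R),
    [/\ continuous S, 0 <= rho < 1,
        forall x, `|f x - y| <= M -> `|f (S x) - y| <= rho * `|f x - y| &
        forall x, f x = y -> S x = x].
Proof.
have [r rP] := fproper (M + `|y|).
have {}rP x : `|f x - y| <= M -> `|x| <= r.
  move=> fM; apply: rP; rewrite -[f x](subrK y).
  by rewrite (le_trans (ler_normD _ _))// lerD2r.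
have [C C0 CP] := invmx_jacobian_bounded r.
have e0 : 0 < (2 * C)^-1 by rewrite invr_gt0 mulr_gt0.
have [d d0 dP] := C1_with_strict r fJ e0.
pose c := C * (`|M| + 1).
have c0 : 0 < c by rewrite mulr_gt0// ltr_wpDl.
(* eta <= 1/2 keeps 1 - eta nonnegative; eta * c < d keeps the step within the radius
   where the linearization is valid. *)
pose eta := Num.min (2^-1) (d / (c *+ 2)).
have eta0 : 0 < eta by rewrite lt_min invr_gt0 ltr0n divr_gt0// mulrn_wgt0.
have eta1 : eta <= 2^-1 by rewrite ge_min lexx.
have etad : eta * c < d.
  have : eta <= d / (c *+ 2) by rewrite ge_min lexx orbT.
  by rewrite ler_pdivlMr ?mulrn_wgt0// mulrnAr mulr2n; have := mulr_gt0 eta0 c0; lra.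
exists (fun x => x - eta *: (invmx (J x) *m (f x - y))), (1 - eta / 2).
split; last by move=> x ->; rewrite subrr mulmx0 scaler0 subr0.
- apply: continuous_sub; first exact: continuous_idfun.
  apply: continuous_scale => x.
  apply: (@continuous_mulmx R _ _ _ _ (fun x => invmx (J x)) (fun x => f x - y)).
    exact: cJi.
  exact: cfB.
- by apply/andP; split; lra.
move=> x fM; set w := f x - y; set u := - (eta *: (invmx (J x) *m w)).
have xr := rP _ fM.
have un : `|u| <= eta * (C * `|w|).
  by rewrite normrN normrZ gtr0_norm// ler_wpM2l ?(ltW eta0)//; exact: CP.
have ud : `|u| < d.
  rewrite (le_lt_trans un)// (le_lt_trans _ etad)// ler_wpM2l ?(ltW eta0)//.
  rewrite /c ler_wpM2l ?(ltW C0)// (le_trans fM)// (le_trans (ler_norm _))//.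
  by rewrite lerDl.
have := dP x u xr ud.
have -> : J x *m u = - (eta *: w).
  by rewrite /u mulmxN -scalemxAr mulKVmx.
rewrite opprK => h.
have -> : f (x + u) - y = (f (x + u) - f x + eta *: w) + (1 - eta) *: w.
  by rewrite /w; apply/matrixP => i j; rewrite !mxE; ring.
rewrite (le_trans (ler_normD _ _))// normrZ ger0_norm; last lra.
have h' : (2 * C)^-1 * `|u| <= eta / 2 * `|w|.
  rewrite (le_trans (ler_wpM2l (ltW e0) un))//.
  have -> : (2 * C)^-1 * (eta * (C * `|w|)) = eta / 2 * `|w|.
    by field; rewrite gt_eqF.
  exact: lexx.
move: (le_trans h h') => hh.
by rewrite (le_trans (lerD hh (lexx _)))// -mulrDl ler_wpM2r//; lra.
Qed.

(** Let [a] and [b] have the same image, and let [M] bound [|f - f a|] on the segment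
    joining them.  Iterating the Newton step [N] times moves the segment to a
    curve from [a] to [b] on which [f] is as close to [f a] as desired.  If [b] is at
    distance at least [d] from [a], then the curve contains a point at distance
    [d / 2] from [a], which [C1_with_expanding] excludes for large [N]. *)
Lemma global_injective : injective f.
Proof.
move=> a b fab.
pose seg (s : R) := a + s *: (b - a).
have cseg : continuous seg.
  exact: continuous_segment.
have cfs : continuous (fun s => `|f (seg s) - f a|).
  apply: (@continuous_normr R R _ (fun s => f (seg s) - f a)).
  apply: (@continuous_funcomp R 'cV[R]_n 'cV[R]_n seg (fun x => f x - f a)).
    exact: cseg.
  exact: cfB.
have [c _ cM] := EVT_max ler01 (continuous_subspaceT cfs).
set M := `|f (seg c) - f a| in cM.
have [S [rho [cS /andP[rho0 rho1] SP Sfix]]] := damped_newton (f a) M.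
have [d [C [d0 C0 dP]]] := C1_with_expanding `|a|.
have iterP k x : `|f x - f a| <= M -> `|f (iter k S x) - f a| <= rho ^+ k * M.
  move=> xM; elim: k => [|k ih]; first by rewrite expr0 mul1r.
  have M0 : 0 <= M by exact: normr_ge0.
  have kM : `|f (iter k S x) - f a| <= M.
    by rewrite (le_trans ih)// ler_piMl// exprn_ile1// ltW.
  rewrite iterS (le_trans (SP _ kM))// exprS -mulrA ler_wpM2l//.
have [N NP] : exists N, C * (rho ^+ N * M) < d / 2.
  have CM0 : 0 < C * (M + 1) by rewrite mulr_gt0// ltr_wpDl// normr_ge0.
  have e0 : 0 < d / 2 / (C * (M + 1)) by rewrite !divr_gt0.
  have rho_norm : `|rho| < 1 by rewrite ger0_norm.
  have /cvgrPdist_lt/(_ _ e0)[N _ /(_ N (leqnn N))] := cvg_expr rho_norm.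
  rewrite sub0r normrN ger0_norm ?exprn_ge0// ltr_pdivlMr// => h; exists N.
  apply: le_lt_trans h; rewrite mulrCA ler_wpM2l ?exprn_ge0//.
  by rewrite ler_wpM2l ?(ltW C0)// lerDl.
have iterfix k x : f x = f a -> iter k S x = x.
  by move=> fxa; elim: k => //= k ->; exact: Sfix.
have citer k : continuous (iter k S).
  by elim: k => [|k ih]; [exact: continuous_idfun|exact: (continuous_funcomp ih cS)].
pose h s := `|iter N S (seg s) - a|.
have ch : continuous h.
  apply: continuous_normr; apply: continuous_sub; last exact: cst_continuous.
  exact: (continuous_funcomp cseg (@citer N)).
have h0 : h 0 = 0 by rewrite /h /seg scale0r addr0 iterfix// subrr normr0.
have h1 : h 1 = `|b - a| by rewrite /h /seg scale1r [a + _]addrC subrK iterfix.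
have [bad|/(dP a)] := leP d `|b - a|; last first.
  rewrite [a + _]addrC subrK -fab subrr normr0 mulr0 => /(_ (lexx _)) ba0.
  by apply/esym/eqP; rewrite -subr_eq0 -normr_le0.
have hd : Num.min (h 0) (h 1) <= d / 2 <= Num.max (h 0) (h 1).
  by rewrite h0 h1 ge_min le_max; apply/andP; split; apply/orP; [left|right]; lra.
have [s s01 hs] := IVT ler01 (continuous_subspaceT ch) hd.
suff : d / 2 < d / 2 by rewrite ltxx.
rewrite -{1}hs /h; set z := iter N S (seg s).
have : `|z - a| <= C * `|f (a + (z - a)) - f a|.
  by apply: dP => //; rewrite -/(h s) hs; lra.
rewrite [a + _]addrC subrK => /le_lt_trans; apply; apply: le_lt_trans NP.
by rewrite ler_pM2l//; apply: iterP; exact: cM.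
Qed.

(** The Newton step cannot decrease [|f - y|] below its minimum, which is therefore 0. *)
Lemma global_surjective y : exists x, f x = y.
Proof.
have [r rP] := fproper (`|f 0 - y| + `|y|).
have [||x xmin] := @coercive_min R n (fun x => `|f x - y|) 0 r.
- by apply: continuous_normr; exact: cfB.
- move=> x fx; apply: rP; rewrite -[f x](subrK y).
  by rewrite (le_trans (ler_normD _ _))// lerD2r.
exists x; have [S [rho [_ /andP[rho0 rho1] SP _]]] := damped_newton y `|f x - y|.
have := le_trans (xmin (S x)) (SP _ (lexx _)).
rewrite -subr_le0 -{1}[`|_|]mul1r -mulrBl pmulr_rle0 ?subr_gt0// normr_le0 subr_eq0.
by move/eqP.
Qed.

(** Continuity of the inverse comes from compactness: away from [g y0], the distance
    from [f] to [y0] is bounded below.  Its derivative is then read off the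
    linearization of [f] at [g y0]. *)
Lemma global_inverse : exists g : 'cV[R]_n -> 'cV[R]_n,
  [/\ cancel f g, cancel g f & C1_with setT g (fun y => invmx (J (g y)))].
Proof.
have [g fg] := choice global_surjective.
have gf : cancel f g by move=> x; apply: global_injective; rewrite fg.
exists g; split; [exact: gf|exact: fg|].
have cg : continuous g.
  move=> y0; apply: continuous_dist => e e0.
  have [r rP] := fproper (`|y0| + 1).
  pose K := [set x : 'cV[R]_n | `|x| <= r] `&` [set x | e - `|x - g y0| <= 0].
  have cK : compact K.
    apply: compact_closedI; first exact: compact_cball.
    apply: closed_fun_le; apply: continuous_sub; first exact: cst_continuous.
    apply: continuous_normr.
    by apply: continuous_sub; [exact: continuous_idfun|exact: cst_continuous].
  have [m m0 mP] : exists2 m, 0 < m & forall x, K x -> m <= `|f x - y0|.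
    have [K0|/set0P K0] := eqVneq K set0; first by exists 1 => // x; rewrite K0.
    have [|c cK' cmin] := compact_EVT_min K0 cK (f := fun x => `|f x - y0|).
      by apply: continuous_subspaceT; apply: continuous_normr; exact: cfB.
    exists `|f c - y0|; last by move=> x Kx; apply: cmin; rewrite inE.
    rewrite normr_gt0 subr_eq0; apply/eqP => fc.
    move: cK'; rewrite inE => -[_ /=]; rewrite -fc gf subrr normr0 subr0.
    by rewrite leNgt e0.
  near=> y.
  have y1 : `|y0 - y| < 1.
    by near: y; exact: (@near_dist R 'cV[R]_n y0).
  have ym : `|y0 - y| < m.
    by near: y; exact: (@near_dist R 'cV[R]_n y0).
  rewrite distrC ltNge; apply/negP => eg.
  have : K (g y).
    split; last by rewrite /= subr_le0.
    apply: rP; rewrite fg -[y](subKr y0) (le_trans (ler_normB _ _))// lerD2l.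
    exact: ltW.
  by move=> /mP; rewrite fg distrC leNgt ym.
move=> y0 _; split; last first.
  exact: (continuous_funcomp cg cJi).
apply/is_diff_mulmx => e e0; set x0 := g y0.
have [d [C [d0 C0 dP]]] := C1_with_expanding `|x0|.
have [C' C'0 CP] := invmx_jacobian_bounded `|x0|.
have e1 : 0 < e / (C * C') by rewrite divr_gt0// mulr_gt0.
have [d' d'0 dP'] := C1_with_strict `|x0| fJ e1.
near=> y; set u := g y - x0.
have ud : `|u| < d.
  by rewrite distrC; near: y; exact: (continuous_near_dist (@cg y0) d0).
have ud' : `|u| < d'.
  by rewrite distrC; near: y; exact: (continuous_near_dist (@cg y0) d'0).
have fu : f (x0 + u) - f x0 = y - y0 by rewrite /u [x0 + _]addrC subrK !fg.
have h1 := dP _ _ (lexx _) ud; have h2 := dP' _ _ (lexx _) ud'.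
rewrite fu in h1 h2.
have -> : u - invmx (J x0) *m (y - y0)
    = - (invmx (J x0) *m (y - y0 - J x0 *m u)).
  by rewrite [in RHS]mulmxBr mulKmx// opprB.
rewrite normrN (le_trans (CP _ _ (lexx _)))//.
apply: (le_trans (ler_wpM2l (ltW C'0) h2)).
apply: (le_trans (ler_wpM2l (ltW C'0) (ler_wpM2l (ltW e1) h1))).
have -> : C' * (e / (C * C') * (C * `|y - y0|)) = e * `|y - y0|.
  by field; rewrite !gt_eqF.
exact: lexx.
Unshelve. all: by end_near. Qed.

End GlobalInversion.

(** * Scalar product and extreme points *)

Section Dot.
Variables (R : realType) (m : nat).
Implicit Types x y t : 'cV[R]_m.

Lemma dotE x y : dot x y = (x^T *m y) 0 0.
Proof. by rewrite mxE; apply: eq_bigr => i _; rewrite mxE. Qed.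

Lemma dotC x y : dot x y = dot y x.
Proof. by apply: eq_bigr => i _; rewrite mulrC. Qed.

Lemma dotDr t x y : dot t (x + y) = dot t x + dot t y.
Proof. by rewrite !dotE mulmxDr mxE. Qed.

Lemma dotBr t x y : dot t (x - y) = dot t x - dot t y.
Proof. by rewrite !dotE mulmxBr !mxE. Qed.

Lemma dotZr a t x : dot t (a *: x) = a * dot t x.
Proof. by rewrite !dotE -scalemxAr mxE. Qed.

Lemma dotNr t x : dot t (- x) = - dot t x.
Proof. by rewrite !dotE mulmxN mxE. Qed.

(** The matrix norm is the maximum norm, which the Euclidean norm dominates. *)
Lemma dot_ge_norm x : `|x| ^+ 2 <= dot x x.
Proof.
have sq0 i : 0 <= x i 0 * x i 0 by rewrite -expr2 sqr_ge0.
have [x0|x0] := eqVneq `|x| 0.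
  by rewrite x0 expr0n /=; exact: sumr_ge0.
have [[i j] /= xE] := mx_norm_neq0 x0.
have -> : `|x| = `|x i j| by [].
rewrite ord1 real_normK ?num_real// /dot (bigD1 i)//= expr2 lerDl.
by apply: sumr_ge0.
Qed.

Lemma dot_eq0 x : dot x x <= 0 -> x = 0.
Proof.
move=> x0; apply/eqP; rewrite -normr_eq0 -sqrf_eq0.
by rewrite eq_le (le_trans (dot_ge_norm x) x0) sqr_ge0.
Qed.

Lemma dot_norm_le x y : `|dot x y| <= m%:R * `|x| * `|y|.
Proof.
rewrite dotE (le_trans (ler_mx_entry _ _ _))// (le_trans (mx_norm_mulmx _ _))//.
rewrite ler_wpM2r// ler_wpM2l//.
by apply: mx_norm_le => // i j; rewrite mxE ler_mx_entry.
Qed.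

Lemma continuous_dot t : continuous (dot t).
Proof.
rewrite (_ : dot t = fun x => (t^T *m x) 0 0); last by apply/funext => x; exact: dotE.
apply: (@continuous_funcomp _ _ _ (mulmx t^T : 'cV[R]_m -> 'cV[R]_1) (fun M => M 0 0)).
  exact: mulmx_continuous.
exact: coord_continuous.
Qed.

Lemma continuous_sqnorm : continuous (fun x => dot x x).
Proof.
have ci i : continuous (fun x : 'cV[R]_m => x i 0 * x i 0).
  by move=> x; apply: (@continuousM _ _ (fun x => x i 0) (fun x => x i 0));
     exact: coord_continuous.
by apply: (continuous_big (@add_continuous R)) => i _; exact: ci.
Qed.

(** Among the maximizers of the functional, one of largest Euclidean norm is extreme,
    since the norm is strictly convex. *)
Lemma dot_max_vertex (Q : set 'cV[R]_m) t : compact Q -> Q !=set0 ->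
  exists2 x, vertices Q x & forall y, Q y -> dot t y <= dot t x.
Proof.
move=> cQ Q0.
have [c cQ' cmax] := compact_EVT_max Q0 cQ (continuous_subspaceT (@continuous_dot t)).
have {}cmax y : Q y -> dot t y <= dot t c by move=> Qy; apply: cmax; rewrite inE.
have Qc : Q c by move: cQ'; rewrite inE.
pose F := Q `&` [set x | dot t c - dot t x <= 0].
have cF : compact F.
  apply: compact_closedI => //; apply: closed_fun_le.
  by apply: continuous_sub; [exact: cst_continuous|exact: continuous_dot].
have F0 : F !=set0 by exists c; split=> //=; rewrite subrr.
have [x + xmax] := compact_EVT_max F0 cF (continuous_subspaceT continuous_sqnorm).
rewrite inE => -[Qx /=]; rewrite subr_le0 => tcx.
have tx : dot t x = dot t c by apply/eqP; rewrite eq_le tcx cmax.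
exists x; last by move=> y /cmax; rewrite tx.
split=> // y z a Qy Qz /andP[a0 a1] xE.
have tE : dot t x = a * dot t y + (1 - a) * dot t z by rewrite xE dotDr !dotZr.
have ty := cmax y Qy; have tz := cmax z Qz.
have b0 : 0 < 1 - a by rewrite subr_gt0.
have Fy : F y.
  split=> //=; rewrite subr_le0.
  have : 0 <= a * (dot t y - dot t c).
    have : (1 - a) * dot t z <= (1 - a) * dot t c by rewrite ler_wpM2l// ltW.
    by move: tE; rewrite tx; lra.
  by rewrite pmulr_rge0// subr_ge0.
have Fz : F z.
  split=> //=; rewrite subr_le0.
  have : 0 <= (1 - a) * (dot t z - dot t c).
    have : a * dot t y <= a * dot t c by rewrite ler_wpM2l// ltW.
    by move: tE; rewrite tx; lra.
  by rewrite pmulr_rge0// subr_ge0.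
have yx : dot y y <= dot x x by apply: xmax; rewrite inE.
have zx : dot z z <= dot x x by apply: xmax; rewrite inE.
(* Strict convexity of the squared norm, as an identity. *)
have key : dot x x = a * dot y y + (1 - a) * dot z z - a * (1 - a) * dot (y - z) (y - z).
  rewrite xE dotBr ![dot (y - z) _]dotC !dotBr [dot z y]dotC.
  rewrite dotDr !dotZr ![dot (_ + _) _]dotC !dotDr !dotZr [dot z y]dotC; ring.
have ab0 : 0 < a * (1 - a) by rewrite mulr_gt0.
have yz : y - z = 0.
  apply: dot_eq0; rewrite -(pmulr_rle0 _ ab0).
  have : a * dot y y <= a * dot x x by rewrite ler_wpM2l// ltW.
  have : (1 - a) * dot z z <= (1 - a) * dot x x by rewrite ler_wpM2l// ltW.
  by move: key; lra.
move/eqP: yz; rewrite subr_eq0 => /eqP yz.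
by rewrite xE yz -scalerDl addrC subrK scale1r.
Qed.

Lemma open_posv : open (@posv R m).
Proof.
move=> x px; apply: (@filter_forall _ _ (fun i (y : 'cV[R]_m) => 0 < y i 0) (nbhs x)) => i.
exact: (@coord_continuous _ _ _ i 0 x _ (lt_nbhsr (px i))).
Qed.

End Dot.

(** * Kernels, images and orthogonal complements *)

Section Subspaces.
Variables (R : realType).

Lemma mem_kerv (k m : nat) (M : 'M[R]_(k, m)) (x : 'cV[R]_m) :
  reflect (M *m x = 0) (x \in kerv M).
Proof. by rewrite memv_ker lfunE/=; exact: eqP. Qed.

Lemma mem_ker_ones (k m : nat) (M : 'M[R]_(k, m)) (x : 'cV[R]_m) :
  x \in ker_ones M <-> M *m x = 0 /\ dot (const_mx 1) x = 0.
Proof.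
have dE : dot (const_mx 1) x = ((const_mx 1 : 'rV[R]_m) *m x) 0 0.
  by rewrite dotE trmx_const.
split=> [/mem_kerv|[Mx x0]].
  rewrite mul_col_mx => /eqP; rewrite col_mx_eq0 => /andP[/eqP -> /eqP x0].
  by rewrite dE x0 mxE.
apply/mem_kerv; rewrite mul_col_mx Mx; apply/eqP; rewrite col_mx_eq0 eqxx /=.
by apply/eqP/matrixP => i j; rewrite !ord1 -dE x0 mxE.
Qed.

Lemma mem_imv (m k : nat) (M : 'M[R]_(m, k)) (x : 'cV[R]_m) :
  x \in imv M <-> exists w, x = M *m w.
Proof.
split=> [/memv_imgP[w _ ->]|[w ->]]; first by exists w; rewrite lfunE.
have -> : M *m w = linfun (mulmx M : 'cV[R]_k -> 'cV[R]_m) w by rewrite lfunE.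
exact: memv_img (memvf w).
Qed.

(** This turns both conditions of the theorem into statements about [H^T]. *)
Lemma orthv_basis (m d : nat) (U : {vspace 'cV[R]_m}) (H : 'M[R]_(m, d)) w :
  basis_of U [seq col j H | j <- enum 'I_d] -> orthv U w <-> H^T *m w = 0.
Proof.
move=> bH; split=> [wU|Hw u].
  apply/matrixP => j k; rewrite ord1 [RHS]mxE.
  have /wU : col j H \in U.
    by apply: (basis_mem bH); apply: map_f; rewrite mem_enum.
  rewrite dotC dotE => <-; rewrite !mxE; apply: eq_bigr => i _.
  by rewrite !mxE.
rewrite -(span_basis bH); move: u.
pose L := linfun (fun u : 'cV[R]_m => w^T *m u).
suff sub : (<<[seq col j H | j <- enum 'I_d]>> <= lker L)%VS.
  move=> u /(subvP sub); rewrite memv_ker lfunE /= dotE => /eqP ->.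
  by rewrite mxE.
apply/span_subvP => _ /mapP[j _ ->]; rewrite memv_ker lfunE /=.
apply/eqP/matrixP => i k; rewrite !ord1 mxE.
move/matrixP: Hw => /(_ j 0); rewrite !mxE => e; rewrite -[RHS]e.
by apply: eq_bigr => q _; rewrite !mxE mulrC.
Qed.

Lemma injective_unitmx (n : nat) (M : 'M[R]_n) :
  (forall h : 'cV[R]_n, M *m h = 0 -> h = 0) -> M \in unitmx.
Proof.
move=> Minj; rewrite -unitmx_tr -row_free_unit; apply: inj_row_free => h hM.
apply: trmx_inj; rewrite trmx0; apply: Minj.
by rewrite -[M]trmxK -trmx_mul hM trmx0.
Qed.

End Subspaces.

(** * The coefficient polytope and its vertices *)

Section Polytope.
Variables (R : realType) (l m : nat) (A : 'M[R]_(l, m)).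
Local Notation P := (coeff_polytope A).

Lemma coeff_polytopeP y :
  P y <-> [/\ A *m y = 0, forall i, 0 < y i 0 & dot (const_mx 1) y = 1].
Proof.
split=> [[[/mem_kerv Ay py] [_ y1]] //|[Ay py y1]].
by split; split=> //; [exact/mem_kerv|move=> i; exact: ltW].
Qed.

Lemma closure_coeff_polytope x : closure P x ->
  [/\ A *m x = 0, forall i, 0 <= x i 0 & dot (const_mx 1) x = 1].
Proof.
have sub (F : set 'cV[R]_m) : closed F -> P `<=` F -> closure P x -> F x.
  by move=> cF PF Px; rewrite closure_id in cF; rewrite cF; exact: closureS Px.
move=> Px; split.
- apply/eqP; rewrite -normr_le0; apply: (sub [set x | `|A *m x| <= 0]) => //.
    apply: closed_fun_le; apply: continuous_normr; exact: mulmx_continuous.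
  by move=> y /coeff_polytopeP[Ay _ _]; rewrite /= Ay normr0.
- move=> i; rewrite -oppr_le0 -sub0r; apply: (sub [set x | 0 - x i 0 <= 0]) => //.
    apply: closed_fun_le; apply: continuous_sub; first exact: cst_continuous.
    exact: coord_continuous.
  by move=> y /coeff_polytopeP[_ py _]; rewrite /= sub0r oppr_le0 ltW.
- apply/eqP; rewrite -subr_eq0 -normr_le0.
  apply: (sub [set x | `|dot (const_mx 1) x - 1| <= 0]) => //.
    apply: closed_fun_le; apply: continuous_normr; apply: continuous_sub.
      exact: continuous_dot.
    exact: cst_continuous.
  by move=> y /coeff_polytopeP[_ _ y1]; rewrite /= y1 subrr normr0.
Qed.

Lemma closure_coeff_polytope_le1 x j : closure P x -> x j 0 <= 1.
Proof.
move=> /closure_coeff_polytope[_ x0 <-].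
rewrite /dot (bigD1 j)//= mxE mul1r lerDl sumr_ge0// => i _.
by rewrite mxE mul1r.
Qed.

Lemma compact_closure_coeff_polytope : compact (closure P).
Proof.
apply: (subclosed_compact _ (@compact_cball R m 1)); first exact: closed_closure.
move=> x Px /=; apply: mx_norm_le => // i j; rewrite ord1.
have [_ x0 _] := closure_coeff_polytope Px.
by rewrite ger0_norm//; exact: closure_coeff_polytope_le1.
Qed.

Lemma coeff_polytope_relopen y : P y ->
  exists2 e, 0 < e & forall u, u \in ker_ones A -> `|u| < e -> P (y + u).
Proof.
move=> /coeff_polytopeP[Ay py y1].
have /nbhs_ballP[e /= e0 eP] : nbhs y (@posv R m).
  by apply: open_nbhs_nbhs; split=> //; exact: open_posv.
exists e => // u /mem_ker_ones[Au u1] ue; apply/coeff_polytopeP; split.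
- by rewrite mulmxDr Ay Au addr0.
- by apply: eP; rewrite -ball_normE /= opprD addrA subrr sub0r normrN.
- by rewrite dotDr y1 u1 addr0.
Qed.

Variables (nP : nat) (v : 'I_nP -> 'cV[R]_m).
Hypothesis hv : range v = vertices (closure P).
Hypothesis P0 : P !=set0.

Lemma vtx_closure k : closure P (v k).
Proof.
have : range v (v k) by exists k.
by rewrite hv => -[].
Qed.

Lemma vtx_ge0 k j : 0 <= v k j 0.
Proof. by have [_ + _] := closure_coeff_polytope (@vtx_closure k); apply. Qed.

Lemma vtx_le1 k j : v k j 0 <= 1.
Proof. exact: closure_coeff_polytope_le1 (@vtx_closure k). Qed.

Lemma vtx_max t : exists k, forall y, closure P y -> dot t y <= dot t (v k).
Proof.
have P0' : closure P !=set0 by case: P0 => y Py; exists y; exact: subset_closure.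
have [x] := dot_max_vertex t compact_closure_coeff_polytope P0'.
by rewrite -hv => -[k _ <-]; exists k.
Qed.

(** Maximize the coordinate [j], which is positive on the polytope. *)
Lemma vtx_pos j : exists k, 0 < v k j 0.
Proof.
have [k kmax] := vtx_max (delta_mx j 0); exists k.
have dj x : dot (delta_mx j 0) x = x j 0.
  rewrite /dot (bigD1 j)//= !mxE !eqxx mul1r big1 ?addr0// => i ij.
  by rewrite mxE (negbTE ij) mul0r.
have [y Py] := P0; have := kmax y (subset_closure Py); rewrite !dj.
by apply: lt_le_trans; have /coeff_polytopeP[_ + _] := Py; apply.
Qed.

(** Since the polytope is relatively open, moving [y] a little along [t] stays in it
    and increases the functional [t], whose maximum is attained at a vertex. *)
Lemma vtx_margin y : P y -> exists2 e, 0 < e &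
  forall t, t \in ker_ones A -> exists k, dot t y + e * `|t| <= dot t (v k).
Proof.
move=> Py; have [e e0 eP] := coeff_polytope_relopen Py.
exists (e / 2); first by rewrite divr_gt0.
move=> t tT; have [k kmax] := vtx_max t; exists k.
have [t0|t0] := eqVneq t 0.
  have -> : `|t| = 0 by rewrite t0 normr0.
  by rewrite mulr0 addr0; apply: kmax; apply: subset_closure.
have nt0 : 0 < `|t| by rewrite normr_gt0.
have s0 : 0 < e / 2 / `|t| by rewrite !divr_gt0.
apply: le_trans (kmax (y + (e / 2 / `|t|) *: t) _); last first.
  apply/subset_closure/eP; first exact: memvZ.
  rewrite normrZ gtr0_norm// divfK ?gt_eqF//.
  by rewrite ltr_pdivrMr// mulr_natr mulr2n ltrDl.
rewrite dotDr lerD2l dotZr -[leRHS]mulrA ler_wpM2l//; first by rewrite divr_ge0// ltW.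
by rewrite ler_pdivlMl//; exact: dot_ge_norm.
Qed.

End Polytope.

(** * The logarithm of F and its Jacobian *)

Section LogParam.
Variables (R : realType) (m d nP : nat) (v : 'I_nP -> 'cV[R]_m) (G : 'M[R]_(m, d)).

Definition vtx_mx : 'M[R]_(m, nP) := \matrix_(i, k) v k i 0.

Definition expo_mx : 'M[R]_(nP, d) := vtx_mx^T *m G.

Definition weights (xi : 'cV[R]_d) : 'cV[R]_nP := map_mx expR (expo_mx *m xi).

Definition wsum (xi : 'cV[R]_d) : 'cV[R]_m := vtx_mx *m weights xi.

Definition wtotal (xi : 'cV[R]_d) : R := dot (const_mx 1) (weights xi).

Lemma vtx_mx_trE t k : (vtx_mx^T *m t) k 0 = dot (v k) t.
Proof. by rewrite mxE; apply: eq_bigr => i _; rewrite !mxE. Qed.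

Lemma expo_mxE xi k : (expo_mx *m xi) k 0 = dot (v k) (G *m xi).
Proof. by rewrite -mulmxA vtx_mx_trE. Qed.

Lemma weightsE xi k : weights xi k 0 = expR (dot (v k) (G *m xi)).
Proof. by rewrite mxE expo_mxE. Qed.

Lemma vtx_mxE c : vtx_mx *m c = \sum_k c k 0 *: v k.
Proof.
apply/matrixP => i j; rewrite ord1 summxE mxE; apply: eq_bigr => k _.
by rewrite !mxE mulrC.
Qed.

Lemma wtotalE xi : wtotal xi = \sum_k expR (dot (v k) (G *m xi)).
Proof. by apply: eq_bigr => k _; rewrite weightsE mxE mul1r. Qed.

Lemma paramE xi : param v G xi = (wtotal xi)^-1 *: wsum xi.
Proof.
rewrite /param wtotalE /wsum vtx_mxE; congr (_ *: _).
by apply: eq_bigr => k _; rewrite weightsE.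
Qed.

Lemma weights_gt0 xi k : 0 < weights xi k 0.
Proof. by rewrite weightsE expR_gt0. Qed.

(** The Jacobian of [param]: the weighted covariance of the vertices, applied
    to [G]. *)
Definition Dparam (xi : 'cV[R]_d) : 'M[R]_(m, d) :=
  (wtotal xi)^-1 *: (vtx_mx *m (diag_mx (weights xi)^T *m expo_mx)
    - (wtotal xi)^-1 *: (wsum xi *m ((weights xi)^T *m expo_mx))).

Lemma Dparam_mul xi h : Dparam xi *m h =
  (wtotal xi)^-1 *: (vtx_mx *m cmul (weights xi) (expo_mx *m h)
    - ((wtotal xi)^-1 * dot (weights xi) (expo_mx *m h)) *: wsum xi).
Proof.
rewrite /Dparam -scalemxAl mulmxBl -scalemxAl -!mulmxA; congr (_ *: (_ - _)).
  congr (_ *m _); apply/matrixP => i j; rewrite mul_diag_mx !mxE /cmul.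
  by rewrite !ord1.
rewrite -scalerA; congr (_ *: _); rewrite [(weights xi)^T *m _]mx11_scalar -dotE.
by rewrite mul_mx_scalar -scalemxAr.
Qed.

(** The logarithm of [F] when [H^T 1 = 0]: the normalizing factor of [param] only
    contributes a multiple of [H^T 1]. *)
Definition logF (H : 'M[R]_(m, d)) (xi : 'cV[R]_d) : 'cV[R]_d :=
  H^T *m map_mx (@ln R) (wsum xi).

(** The chain rule for [logF], one factor for each of the maps that compose it. *)
Definition JlogF (H : 'M[R]_(m, d)) (xi : 'cV[R]_d) : 'M[R]_d :=
  H^T *m (diag_mx (map_mx GRing.inv (wsum xi))^T *m
    (vtx_mx *m (diag_mx (weights xi)^T *m expo_mx))).

Hypothesis wsum_pos : forall xi j, 0 < wsum xi j 0.

Lemma C1_with_logF H : C1_with setT (logF H) (JlogF H).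
Proof.
have cW := @C1_with_mulmx R d nP setT expo_mx.
have cE := @C1_with_expR R nP.
have cV := @C1_with_mulmx R nP m setT vtx_mx.
have cL := @C1_with_ln R m.
have cH := @C1_with_mulmx R m d setT H^T.
have c1 := C1_with_comp cW cE (fun _ _ => I).
have c2 := C1_with_comp c1 cV (fun _ _ => I).
have c3 := C1_with_comp c2 cL (fun xi _ => wsum_pos xi).
exact: (C1_with_comp c3 cH (fun _ _ => I)).
Qed.

Hypothesis wtotal_pos : forall xi, 0 < wtotal xi.

(** The logarithmic derivative of [param] and that of [wsum] differ by a multiple of the
    all-ones vector, which [H^T] annihilates. *)
Lemma JlogF_Dparam H xi h : H^T *m const_mx 1 = 0 :> 'cV[R]_d ->
  JlogF H xi *m h =
  H^T *m \col_j ((Dparam xi *m h) j 0 / param v G xi j 0).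
Proof.
move=> H1; set mu := (wtotal xi)^-1 * dot (weights xi) (expo_mx *m h).
have -> : \col_j ((Dparam xi *m h) j 0 / param v G xi j 0) =
    diag_mx (map_mx GRing.inv (wsum xi))^T *m
      (vtx_mx *m cmul (weights xi) (expo_mx *m h)) - mu *: const_mx 1.
  apply/matrixP => j k; rewrite ord1 Dparam_mul -/mu paramE mul_diag_mx.
  have := wsum_pos xi j; move: (wsum xi) (vtx_mx *m _) => S w Sj.
  have := wtotal_pos xi; move: (wtotal xi) => Z Z0.
  by rewrite !mxE; field; rewrite !gt_eqF.
rewrite mulmxBr -scalemxAr H1 scaler0 subr0 /JlogF -!mulmxA.
congr (_ *m (_ *m (_ *m _))); apply/matrixP => i j.
by rewrite mul_diag_mx !mxE !ord1.
Qed.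

Lemma param_coordE xi i : param v G xi i 0 = (wtotal xi)^-1 * wsum xi i 0.
Proof. by rewrite paramE mxE. Qed.

Lemma param_gt0 xi i : 0 < param v G xi i 0.
Proof. by rewrite param_coordE mulr_gt0 ?invr_gt0. Qed.

Lemma mapF_logF H xi : H^T *m const_mx 1 = 0 :> 'cV[R]_d ->
  mapF v G H xi = map_mx expR (logF H xi).
Proof.
move=> H1; apply/matrixP => j k; rewrite ord1 /mapF /monom [LHS]mxE [RHS]mxE.
have -> : logF H xi j 0 = \sum_i H i j * ln (param v G xi i 0).
  transitivity (\sum_i (H i j * ln (param v G xi i 0) + H i j * ln (wtotal xi))).
    rewrite /logF mxE; apply: eq_bigr => i _.
    rewrite -mulrDr -lnM ?posrE ?param_gt0//.
    by rewrite param_coordE mulrAC mulVf ?mul1r ?gt_eqF// !mxE.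
  rewrite big_split /= -mulr_suml.
  have -> : \sum_i H i j = 0.
    move/matrixP: H1 => /(_ j 0); rewrite !mxE => e; rewrite -[RHS]e.
    by apply: eq_bigr => i _; rewrite !mxE mulr1.
  by rewrite mul0r addr0.
rewrite expR_sum; apply: eq_bigr => i _.
by rewrite /powR gt_eqF// param_gt0.
Qed.

End LogParam.

(** * The parametrization of the polytope *)

Section ParamGeometry.
Variables (R : realType) (l m d nP : nat) (A : 'M[R]_(l, m)).
Variables (v : 'I_nP -> 'cV[R]_m) (G : 'M[R]_(m, d)).
Local Notation P := (coeff_polytope A).
Hypothesis hv : range v = vertices (closure P).
Hypothesis P0 : P !=set0.
Hypothesis G_orth : G^T *m G = 1%:M.
Hypothesis G_im : imv G = ker_ones A.

Let v_ge0 := vtx_ge0 hv.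

Lemma wsum_gt0 xi j : 0 < wsum v G xi j 0.
Proof.
have [k vk] := vtx_pos hv P0 j.
rewrite /wsum vtx_mxE summxE (bigD1 k)//= ltr_pwDl//.
  by rewrite mxE mulr_gt0// weights_gt0.
by apply: sumr_ge0 => i _; rewrite mxE mulr_ge0// ltW// weights_gt0.
Qed.

Lemma wtotal_gt0 xi : 0 < wtotal v G xi.
Proof.
have [k _] := vtx_max hv P0 0.
rewrite wtotalE (bigD1 k)//= ltr_pwDl ?expR_gt0//.
by apply: sumr_ge0 => i _; exact: expR_ge0.
Qed.

Lemma mul_vtx_mx_ker (c : 'cV[R]_nP) : A *m (vtx_mx v *m c) = 0.
Proof.
rewrite vtx_mxE mulmx_sumr big1// => k _; rewrite -scalemxAr.
by have [-> _ _] := closure_coeff_polytope (vtx_closure hv (k := k)); rewrite scaler0.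
Qed.

Lemma dot1_vtx_mx (c : 'cV[R]_nP) : dot (const_mx 1) (vtx_mx v *m c) = dot (const_mx 1) c.
Proof.
rewrite vtx_mxE dotE mulmx_sumr summxE; apply: eq_bigr => k _.
rewrite -scalemxAr mxE -dotE.
by have [_ _ ->] := closure_coeff_polytope (vtx_closure hv (k := k)); rewrite mxE mulrC.
Qed.

Lemma param_coeff_polytope xi : P (param v G xi).
Proof.
apply/coeff_polytopeP; split.
- by rewrite paramE -scalemxAr mul_vtx_mx_ker scaler0.
- by move=> i; apply: param_gt0; [exact: wsum_gt0|exact: wtotal_gt0].
- by rewrite paramE dotZr dot1_vtx_mx mulVf// gt_eqF// wtotal_gt0.
Qed.

(** On the image of [G], the matrix [G^T] is a left inverse. *)
Lemma tangent_dot0 t : t \in ker_ones A -> G^T *m t = 0 -> t = 0.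
Proof.
by rewrite -G_im => /mem_imv[w ->]; rewrite mulmxA G_orth mul1mx => ->; rewrite mulmx0.
Qed.

Lemma Dparam_tangent xi (h : 'cV[R]_d) : Dparam v G xi *m h \in ker_ones A.
Proof.
rewrite Dparam_mul; apply: memvZ; apply/mem_ker_ones; split.
  by rewrite mulmxBr -scalemxAr !mul_vtx_mx_ker scaler0 subr0.
rewrite dotBr dotZr !dot1_vtx_mx mulrAC.
rewrite -/(wtotal v G xi) mulVf ?gt_eqF ?wtotal_gt0// mul1r.
rewrite [X in X - _](_ : _ = dot (weights v G xi) (expo_mx v G *m h)) ?subrr//.
by apply: eq_bigr => k _; rewrite !mxE mul1r.
Qed.

(** The product of [Dparam xi *m h] with [G h] is the weighted variance of the numbers
    [c_k = v_k . G h].  If it vanishes, the functional [G h] is constant on the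
    vertices, hence on the polytope, and [vtx_margin] leaves only [G h = 0]. *)
Lemma Dparam_inj xi (h : 'cV[R]_d) : Dparam v G xi *m h = 0 -> h = 0.
Proof.
move=> Dh; set w := weights v G xi; set c := expo_mx v G *m h.
set Z := wtotal v G xi; have Z0 : 0 < Z := wtotal_gt0 xi.
set mu := Z^-1 * dot w c.
have ZE : Z = \sum_k w k 0 by apply: eq_bigr => k _; rewrite mxE mul1r.
have muZ : mu * Z = dot w c by rewrite /mu mulrAC mulVf ?mul1r// gt_eqF.
(* The weights are not normalized; mu is the weighted mean of c. *)
have var0 : \sum_k w k 0 * (c k 0 - mu) ^+ 2 = 0.
  have : dot (G *m h) (Z *: (Dparam v G xi *m h)) = 0 by rewrite Dh scaler0 dotE mulmx0 mxE.
  rewrite Dparam_mul -/w -/c -/Z -/mu scalerA mulfV ?gt_eqF// scale1r.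
  have dV x : dot (G *m h) (vtx_mx v *m x) = dot c x.
    rewrite !dotE mulmxA /c /expo_mx -[_ *m G *m h]mulmxA.
    by move: (G *m h) => g; rewrite [in RHS]trmx_mul trmxK.
  rewrite dotBr dotZr /wsum !dV -/w => e0.
  transitivity (dot c (cmul w c) - mu * dot c w + mu * (mu * Z - dot w c)); last first.
    by rewrite e0 add0r muZ subrr mulr0.
  rewrite ZE /dot !(mulr_sumr, =^~ sumrN, =^~ big_split) /=.
  by apply: eq_bigr => k _; rewrite [cmul w c k 0]mxE; ring.
have cmu k : dot (v k) (G *m h) = mu.
  rewrite -expo_mxE -/c.
  move/eqP: var0; rewrite psumr_eq0; last first.
    by move=> i _; rewrite mulr_ge0 ?sqr_ge0// ltW// weights_gt0.
  move=> /allP/(_ k (mem_index_enum k)); rewrite mulf_eq0 gt_eqF ?weights_gt0//=.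
  by rewrite sqrf_eq0 subr_eq0 => /eqP.
have hT : G *m h \in ker_ones A by rewrite -G_im; apply/mem_imv; exists h.
have [y Py] := P0.
have [e e0 eP] := vtx_margin hv P0 Py.
have Gh0 : G *m h = 0.
  have [k1] := eP _ hT; have := eP (- (G *m h)).
  rewrite memvN => /(_ hT)[k2].
  rewrite normrN [dot (- _) y]dotC [dot (- _) _]dotC !dotNr cmu.
  rewrite [dot (G *m h) y]dotC [dot (G *m h) _]dotC cmu => h2 h1.
  have : e * `|G *m h| <= 0 by move: h1 h2; lra.
  by rewrite pmulr_rle0// normr_le0 => /eqP.
by rewrite -[h]mul1mx -G_orth -mulmxA Gh0 mulmx0.
Qed.

Lemma Dparam_surj xi (t : 'cV[R]_m) : t \in ker_ones A -> exists h, Dparam v G xi *m h = t.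
Proof.
move=> tT; pose M := G^T *m Dparam v G xi.
have Mu : M \in unitmx.
  apply: injective_unitmx => h; rewrite -mulmxA => Mh.
  by apply/(@Dparam_inj xi)/tangent_dot0; first exact: Dparam_tangent.
exists (invmx M *m (G^T *m t)); apply/eqP; rewrite -subr_eq0; apply/eqP.
apply: tangent_dot0; first by rewrite memvB// Dparam_tangent.
by rewrite mulmxBr mulmxA -/M mulKVmx// subrr.
Qed.

(** Given [y], minimize [sum_k exp ((v_k - y) . G xi)]: this is coercive by
    [vtx_margin], and the vanishing of its gradient says that the projection of
    [param xi - y] to the tangent space is 0. *)
Lemma param_surj y : P y -> exists xi, param v G xi = y.
Proof.
move=> Py; have [Ay _ y1] := (coeff_polytopeP _ _).1 Py.
(* Translating the vertices by y keeps the exponents of the form used for F. *)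
pose v' k := v k - y.
pose Psi (xi : 'cV[R]_d) : 'cV[R]_1 := (const_mx 1 : 'rV[R]_nP) *m weights v' G xi.
have cPsi : C1_with setT Psi (fun xi => (const_mx 1 : 'rV[R]_nP)
    *m (diag_mx (weights v' G xi)^T *m expo_mx v' G)).
  have cW := @C1_with_mulmx R d nP setT (expo_mx v' G).
  have cS := @C1_with_mulmx R nP 1 setT (const_mx 1).
  have cWE := C1_with_comp cW (@C1_with_expR R nP) (fun _ _ => I).
  exact: (C1_with_comp cWE cS (fun _ _ => I)).
have PsiE xi : Psi xi 0 0 = \sum_k expR (dot (v' k) (G *m xi)).
  by rewrite -wtotalE /Psi /wtotal dotE trmx_const.
have [e e0 eP] := vtx_margin hv P0 Py.
have GT xi : G *m xi \in ker_ones A by rewrite -G_im; apply/mem_imv; exists xi.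
have Psi_ge xi : 1 + e * `|G *m xi| <= Psi xi 0 0.
  have [k kP] := eP _ (GT xi); rewrite PsiE (bigD1 k)//=.
  rewrite -[leLHS]addr0 lerD//; last by apply: sumr_ge0 => i _; exact: expR_ge0.
  apply: le_trans (expR_ge1Dx _); rewrite lerD2l.
  by rewrite dotC dotBr lerBrDl.
have xi_le (xi : 'cV[R]_d) : `|xi| <= m%:R * `|G^T| * `|G *m xi|.
  by rewrite -{1}[xi]mul1mx -G_orth -mulmxA mx_norm_mulmx.
have [||xi xi_min] := @coercive_min R d (fun xi => Psi xi 0 0) 0
    (m%:R * `|G^T| * ((Psi 0 0 0 - 1) / e)).
- apply: (@continuous_funcomp _ _ _ Psi (fun M => M 0 0)).
    by move=> xi; exact: (C1_with_continuous cPsi).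
  exact: coord_continuous.
- move=> xi xi0; apply: (le_trans (xi_le xi)); rewrite ler_wpM2l// ?mulr_ge0//.
  by rewrite ler_pdivlMr// mulrC lerBrDl (le_trans (Psi_ge xi)).
exists xi; set u := vtx_mx v' *m weights v' G xi.
have u0 : u = 0.
  apply: tangent_dot0.
    rewrite /u vtx_mxE; apply: memv_suml => k _; apply: memvZ.
    have [Av _ v1] := closure_coeff_polytope (vtx_closure hv (k := k)).
    by apply/mem_ker_ones; rewrite mulmxBr dotBr Av Ay v1 y1 !subrr.
  apply/matrixP => i j; rewrite ord1 [RHS]mxE.
  have gradE : (const_mx 1 : 'rV[R]_nP) *m (diag_mx (weights v' G xi)^T *m expo_mx v' G)
      = u^T *m G.
    rewrite mulmxA /expo_mx mulmxA /u trmx_mul; congr (_ *m _ *m _).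
    by apply/matrixP => a b; rewrite mul_mx_diag !mxE mul1r ord1.
  have := C1_with_min (delta_mx i 0) cPsi xi_min.
  rewrite gradE => uG; rewrite -[RHS]uG -colE !mxE.
  by apply: eq_bigr => k _; rewrite !mxE mulrC.
have w'E k : weights v' G xi k 0 = expR (- dot y (G *m xi)) * weights v G xi k 0.
  by rewrite !weightsE dotC dotBr [dot _ y]dotC [dot _ (v k)]dotC addrC expRD.
have : expR (- dot y (G *m xi)) *: (wsum v G xi - wtotal v G xi *: y) = 0.
  rewrite -[RHS]u0 /u /wsum !vtx_mxE wtotalE scaler_suml -sumrB scaler_sumr.
  by apply: eq_bigr => k _; rewrite -weightsE -scalerBr scalerA w'E.
move/eqP; rewrite scaler_eq0 gt_eqF ?expR_gt0//= subr_eq0 => /eqP SE.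
by rewrite paramE SE scalerA mulVf ?scale1r// gt_eqF// wtotal_gt0.
Qed.

End ParamGeometry.

(** * Behaviour of the logarithm of F at infinity *)

Section Asymptotics.
Variables (R : realType) (l m d nP : nat) (A : 'M[R]_(l, m)).
Variables (v : 'I_nP -> 'cV[R]_m) (G : 'M[R]_(m, d)).
Local Notation P := (coeff_polytope A).
Hypothesis hv : range v = vertices (closure P).
Hypothesis P0 : P !=set0.
Hypothesis G_orth : G^T *m G = 1%:M.
Hypothesis G_im : imv G = ker_ones A.
Local Notation mu := (mu_max v).

Let v_ge0 := vtx_ge0 hv.
Let v_le1 := vtx_le1 hv.

(** Together with [mu_max_ub] this characterizes [mu_max] by finite maxima: some
    vertex has a positive coordinate [j], so that the default value of an empty
    maximum does not occur. *)
Lemma mu_max_attained t j :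
  exists2 k, v k j 0 != 0 & mu t j 0 = dot (v k) t.
Proof.
have [k0 /lt0r_neq0 vk0] := vtx_pos hv P0 j.
rewrite mxE (@bigmax_eq_arg _ _ _ _ k0)//; last by move=> i _; exact: leNye.
by case: arg_maxP => // k vk _; exists k.
Qed.

Lemma mu_max_ub t j k : v k j 0 != 0 -> dot (v k) t <= mu t j 0.
Proof.
move=> vk; have [k0 vk0] := mu_max_attained t j.
have : ((dot (v k) t)%:E <=
    \big[maxe/-oo%E]_(k < nP | v k j 0%R != 0%R) (dot (v k) t)%:E)%E.
  exact: le_bigmax_cond.
rewrite mxE; set b := (\big[_/_]_(_ < _ | _) _)%E.
have : (b < +oo)%E by apply/bigmax_ltP; split=> // i _; exact: ltry.
by case: b => //= r _; rewrite lee_fin.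
Qed.

Lemma mu_max_scale s t : 0 < s -> mu (s *: t) = s *: mu t.
Proof.
move=> s0; apply/matrixP => j i; rewrite ord1 [RHS]mxE; apply/eqP.
rewrite eq_le; apply/andP; split.
  have [k vk ->] := mu_max_attained (s *: t) j.
  by rewrite dotZr ler_pM2l// mu_max_ub.
have [k vk ->] := mu_max_attained t j.
by rewrite -dotZr mu_max_ub.
Qed.

Lemma mu_max_lipschitz t t' : `|mu t - mu t'| <= m%:R * `|t - t'|.
Proof.
have half a b j : mu a j 0 - mu b j 0 <= m%:R * `|a - b|.
  have [k vk ->] := mu_max_attained a j.
  have := mu_max_ub b vk.
  have : dot (v k) (a - b) <= m%:R * `|a - b|.
    rewrite (le_trans (ler_norm _))// (le_trans (dot_norm_le _ _))//.
    rewrite ler_wpM2r// ler_piMr//.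
    by apply: mx_norm_le => // i i'; rewrite ord1 ger0_norm.
  rewrite dotBr; lra.
apply: mx_norm_le => [|j i]; first by rewrite mulr_ge0.
have -> : (mu t - mu t') j i = mu t j 0 - mu t' j 0.
  by rewrite ord1; move: (mu t) (mu t') => a b; rewrite !mxE.
by rewrite ler_norml lerNl opprB half andbT -normrN opprB half.
Qed.

(** A sum of positive terms lies between its largest term and [nP] times it; the
    nonzero coordinates of the vertices are at most 1, and their logarithms
    are bounded. *)
Lemma ln_wsum_mu_max : exists C, forall xi : 'cV[R]_d,
  `|map_mx (@ln R) (wsum v G xi) - mu (G *m xi)| <= C.
Proof.
exists (`|map_mx (@ln R) (vtx_mx v)| + `|ln nP%:R|) => xi.
apply: mx_norm_le => [|j i]; first by rewrite addr_ge0.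
rewrite ord1 {i}; set t := G *m xi.
have -> : (map_mx (@ln R) (wsum v G xi) - mu t) j 0 = ln (wsum v G xi j 0) - mu t j 0.
  by move: (mu t) (wsum _ _ _) => a b; rewrite !mxE.
have SE : wsum v G xi j 0 = \sum_k expR (dot (v k) t) * v k j 0.
  by rewrite /wsum vtx_mxE summxE; apply: eq_bigr => k _; rewrite mxE weightsE.
have S0 := wsum_gt0 G hv P0 xi j.
have [k0 vk0 muE] := mu_max_attained t j.
have vk0' : 0 < v k0 j 0 by rewrite lt0r vk0 v_ge0.
rewrite ler_norml; apply/andP; split.
  have h1 : ln (v k0 j 0) + mu t j 0 <= ln (wsum v G xi j 0).
    rewrite -[mu t j 0]expRK -lnM ?posrE ?expR_gt0// ler_ln ?posrE ?mulr_gt0 ?expR_gt0//.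
    rewrite SE muE (bigD1 k0)//= mulrC lerDl; apply: sumr_ge0 => k _.
    by rewrite mulr_ge0// expR_ge0.
  have h2 : - ln (v k0 j 0) <= `|map_mx (@ln R) (vtx_mx v)|.
    rewrite (le_trans (ler_norm _))// normrN.
    by have := ler_mx_entry (map_mx (@ln R) (vtx_mx v)) j k0; rewrite !mxE.
  by have := normr_ge0 (ln (nP%:R : R)); lra.
have h1 : wsum v G xi j 0 <= nP%:R * expR (mu t j 0).
  rewrite SE -[nP in nP%:R]card_ord mulr_natl -sumr_const; apply: ler_sum => k _.
  have [->|vk] := eqVneq (v k j 0) 0; first by rewrite mulr0 expR_ge0.
  rewrite (@le_trans _ _ (expR (dot (v k) t)))//.
    by rewrite ler_piMr ?expR_ge0.
  by rewrite ler_expR mu_max_ub.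
have nP0 : 0 < (nP%:R : R) by rewrite ltr0n (leq_ltn_trans _ (ltn_ord k0)).
have h2 : ln (wsum v G xi j 0) <= ln nP%:R + mu t j 0.
  rewrite -[mu t j 0]expRK -lnM ?posrE ?expR_gt0// ler_ln ?posrE ?mulr_gt0 ?expR_gt0//.
have := ler_norm (ln (nP%:R : R)); have := normr_ge0 (map_mx (@ln R) (vtx_mx v)); lra.
Qed.

Lemma logF_mu_max (H : 'M[R]_(m, d)) : exists C, forall xi,
  `|logF v G H xi - H^T *m mu (G *m xi)| <= C.
Proof.
have [C CP] := ln_wsum_mu_max.
exists (m%:R * `|H^T| * C) => xi; rewrite -mulmxBr.
by rewrite (le_trans (mx_norm_mulmx _ _))// ler_wpM2l// mulr_ge0.
Qed.

Lemma continuous_mu_max (H : 'M[R]_(m, d)) :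
  continuous (fun xi : 'cV[R]_d => H^T *m mu (G *m xi)).
Proof.
apply: (@continuous_funcomp _ _ _
  (fun xi : 'cV[R]_d => mu (G *m xi)) (mulmx H^T)); last first.
  exact: mulmx_continuous.
apply: (@continuous_funcomp _ _ _ (mulmx G : 'cV[R]_d -> 'cV[R]_m) (fun t => mu t)).
  exact: mulmx_continuous.
move=> t; apply: continuous_dist => e e0.
have e1 : 0 < e / m.+1%:R by rewrite divr_gt0.
near=> t'.
rewrite (le_lt_trans (mu_max_lipschitz _ _))//.
rewrite (@le_lt_trans _ _ (m.+1%:R * `|t - t'|))//.
  by rewrite ler_wpM2r// ler_nat.
rewrite mulrC -ltr_pdivlMr//; near: t'; exact: (near_dist t e1).
Unshelve. all: by end_near. Qed.

(** By compactness of the unit sphere and homogeneity, [H^T (mu_max (G xi))] grows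
    at least linearly in [xi]. *)
Lemma logF_proper (H : 'M[R]_(m, d)) :
  (forall t, t \in ker_ones A -> t != 0 -> H^T *m mu t <> 0) ->
  forall M : R, exists r, forall xi, `|logF v G H xi| <= M -> `|xi| <= r.
Proof.
move=> Hmu M.
pose N (xi : 'cV[R]_d) := `|H^T *m mu (G *m xi)|.
have [C CP] := logF_mu_max H.
have [c c0 cP] : exists2 c, 0 < c & forall xi, c * `|xi| <= N xi.
  (* The unit sphere, which is empty for d = 0. *)
  pose K := [set x : 'cV[R]_d | `|x| <= 1] `&` [set x | 1 - `|x| <= 0].
  have cK : compact K.
    apply: compact_closedI; first exact: compact_cball.
    apply: closed_fun_le; apply: continuous_sub; first exact: cst_continuous.
    by apply: continuous_normr; exact: continuous_idfun.
  have [c c0 cP] : exists2 c, 0 < c & forall xi, K xi -> c <= N xi.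
    have [K0|/set0P K0] := eqVneq K set0; first by exists 1 => // xi; rewrite K0.
    have [|xi + xi_min] := compact_EVT_min K0 cK (f := N).
      apply: continuous_subspaceT; apply: continuous_normr; exact: continuous_mu_max.
    rewrite inE => -[_ /=]; rewrite subr_le0 => xi1.
    exists (N xi); last by move=> x Kx; apply: xi_min; rewrite inE.
    rewrite normr_gt0; apply/eqP/Hmu; first by rewrite -G_im; apply/mem_imv; exists xi.
    apply/eqP => G0; move: xi1; rewrite -[xi]mul1mx -G_orth -mulmxA G0 mulmx0 normr0.
    by rewrite ler10.
  exists c => // xi; have [->|xi0] := eqVneq xi 0; first by rewrite normr0 mulr0 normr_ge0.
  have n0 : 0 < `|xi| by rewrite normr_gt0.
  have n1 : `| `|xi|^-1 *: xi| = 1.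
    by rewrite normrZ gtr0_norm ?invr_gt0// mulVf// gt_eqF.
  have := cP (`|xi|^-1 *: xi); rewrite /K /= n1 subrr => /(_ (conj (lexx _) (lexx _))).
  rewrite /N -scalemxAr mu_max_scale ?invr_gt0// -scalemxAr normrZ gtr0_norm ?invr_gt0//.
  by rewrite ler_pdivlMl// mulrC.
exists ((M + C) / c) => xi fM; rewrite ler_pdivlMr// mulrC (le_trans (cP xi))//.
rewrite /N -[_ *m _](subKr (logF v G H xi)) (le_trans (ler_normB _ _))//.
by rewrite lerD.
Qed.

End Asymptotics.

(** * The two conditions *)

Section Main.
Variables (R : realType) (l m d nP : nat) (A : 'M[R]_(l, m)).
Variables (v : 'I_nP -> 'cV[R]_m) (G : 'M[R]_(m, d)) (H : 'M[R]_(m, d)).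
Local Notation P := (coeff_polytope A).
Hypothesis hv : range v = vertices (closure P).
Hypothesis P0 : P !=set0.
Hypothesis G_orth : G^T *m G = 1%:M.
Hypothesis G_im : imv G = ker_ones A.
Hypothesis H1 : H^T *m const_mx 1 = 0 :> 'cV[R]_d.

Let wsum_pos := wsum_gt0 G hv P0.
Let wtotal_pos := wtotal_gt0 G hv P0.

Let mapFE : mapF v G H = map_mx expR \o logF v G H.
Proof. by apply/funext => xi; exact: mapF_logF. Qed.

Let JmapF xi := diag_mx (map_mx expR (logF v G H xi))^T *m JlogF v G H xi.

Lemma C1_with_mapF : C1_with setT (mapF v G H) JmapF.
Proof.
rewrite mapFE.
exact: (C1_with_comp (C1_with_logF wsum_pos H) (@C1_with_expR R d) (fun _ _ => I)).
Qed.

Lemma map_expRK (p : nat) : cancel (map_mx (@expR R) : 'cV_p -> 'cV_p) (map_mx (@ln R)).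
Proof. by move=> x; apply/matrixP => i j; rewrite !mxE expRK. Qed.

Lemma map_lnK (p : nat) (x : 'cV[R]_p) : posv x -> map_mx expR (map_mx (@ln R) x) = x.
Proof. by move=> px; apply/matrixP => i j; rewrite !mxE ord1 lnK// posrE. Qed.

Lemma posv_expR (p : nat) (x : 'cV[R]_p) : posv (map_mx expR x).
Proof. by move=> i; rewrite mxE expR_gt0. Qed.

Lemma diffeomorphism_mapF :
  ~ (exists y t db : 'cV[R]_m,
        [/\ P y, t \in ker_ones A /\ t != 0, H^T *m db = 0 & t = cmul y db]) ->
  (forall t, t \in ker_ones A -> t != 0 -> H^T *m mu_max v t <> 0) ->
  diffeomorphism setT (@posv R d) (mapF v G H).
Proof.
move=> hi hii.
have Junit xi : JlogF v G H xi \in unitmx.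
  apply: injective_unitmx => h Jh; apply/eqP/negPn/negP => h0.
  apply: hi; set t := Dparam v G xi *m h.
  exists (param v G xi), t, (\col_j (t j 0 / param v G xi j 0)); split.
  - exact: param_coeff_polytope hv P0 xi.
  - split; first exact: Dparam_tangent hv P0 xi h.
    by apply: contra h0 => /eqP t0; apply/eqP/(Dparam_inj hv P0 G_orth G_im t0).
  - by rewrite -JlogF_Dparam.
  - apply/matrixP => i j; rewrite ord1 [RHS]mxE [(\col__ _) _ _]mxE mulrC divfK//.
    by rewrite gt_eqF// param_gt0.
have [g [fK gK cg]] := global_inverse (C1_with_logF wsum_pos H) Junit
  (logF_proper hv P0 G_orth G_im hii).
have cF := C1_with_mapF.
have cL := @C1_with_ln R d.
have cgL := C1_with_comp cL cg (fun _ _ => I).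
split.
- split.
  + by move=> xi _; rewrite mapFE; exact: posv_expR.
  + move=> x y _ _; rewrite mapFE /= => e; apply: (can_inj fK).
    exact: (can_inj (@map_expRK d)).
  + move=> y py; exists (g (map_mx (@ln R) y)) => //.
    by rewrite mapFE /= gK map_lnK.
- exact: C1_with_C1_on openT cF.
exists (g \o map_mx (@ln R)); split.
- by move=> x _; rewrite mapFE /= map_expRK fK.
- by move=> y py; rewrite mapFE /= gK map_lnK.
- exact: C1_with_C1_on (@open_posv R d) cgL.
Qed.

(** A solution [t = y o db] would give a direction in which the derivative of [F]
    vanishes, against the chain rule for the identity [g \o F]. *)
Lemma diffeomorphism_mapF_tangent :
  diffeomorphism setT (@posv R d) (mapF v G H) ->
  ~ (exists y t db : 'cV[R]_m,
        [/\ P y, t \in ker_ones A /\ t != 0, H^T *m db = 0 & t = cmul y db]).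
Proof.
move=> [[Fpos _ _] _ [g [gF _ cg]]] [y [t [db [Py [tT t0] Hdb tE]]]].
have [xi xiE] := param_surj hv P0 G_orth G_im Py.
have [h hE] := Dparam_surj hv P0 G_orth G_im xi tT.
have Jh : JlogF v G H xi *m h = 0.
  rewrite JlogF_Dparam// hE xiE -[RHS]Hdb; congr (_ *m _).
  apply/matrixP => i j; rewrite ord1 mxE tE mxE mulrC mulKf//.
  by have [_ /(_ i) yi _] := (coeff_polytopeP _ _).1 Py; rewrite gt_eqF.
have [dF _] := C1_with_mapF (I : setT xi).
have [dg _] := cg _ (Fpos xi I).
have dgF := is_diff_comp dF (differentiableP dg).
have gFE : g \o mapF v G H = id by apply/funext => x; exact: gF.
rewrite gFE in dgF.
have e : (id : 'cV[R]_d -> 'cV[R]_d) = 'd g (mapF v G H xi) \o mulmx (JmapF xi).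
  by rewrite -(@diff_val _ _ _ _ _ _ _ dgF) (@diff_val _ _ _ _ _ _ _ (is_diff_id xi)).
have h0 : h = 0.
  have := congr1 (@^~ h) e; rewrite /= /JmapF -mulmxA Jh mulmx0 linear0.
  by [].
by move: t0; rewrite -hE h0 mulmx0 eqxx.
Qed.

(** If [H^T (mu_max (G w)) = 0], then [logF] is bounded on the ray of [w], so that
    [F] maps the ray into a compact subset of the positive orthant, on which the
    continuous inverse of [F] is bounded. *)
Lemma diffeomorphism_mapF_mu_max :
  diffeomorphism setT (@posv R d) (mapF v G H) ->
  forall t, t \in ker_ones A -> t != 0 -> H^T *m mu_max v t <> 0.
Proof.
move=> [_ _ [g [gF _ cg]]] t; rewrite -G_im => /mem_imv[w ->] t0 Hmu.
have [C CP] := logF_mu_max G hv P0 H.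
have fC s : 0 < s -> `|logF v G H (s *: w)| <= C.
  move=> s0; have := CP (s *: w).
  by rewrite -scalemxAr (mu_max_scale hv P0)// -scalemxAr Hmu scaler0 subr0.
have cgE : continuous (fun x => `|g (map_mx expR x)|).
  apply: continuous_normr => x.
  apply: (@continuous_comp _ _ _ (map_mx (@expR R) : 'cV_d -> 'cV_d) g).
    exact: (C1_with_continuous (@C1_with_expR R d) I).
  by have [dg _] := cg _ (posv_expR x); exact: differentiable_continuous.
have C0 : 0 <= C by exact: le_trans (normr_ge0 _) (fC 1 ltr01).
have [|c _ cmax] := compact_EVT_max _ (@compact_cball R d C) (continuous_subspaceT cgE).
  by exists 0; rewrite /= normr0.
set N := `|g (map_mx expR c)| in cmax.
have w0 : 0 < `|w|.
  by rewrite normr_gt0; apply: contra t0 => /eqP ->; rewrite mulmx0.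
have sN s : 0 < s -> s * `|w| <= N.
  move=> s0; rewrite -[s]gtr0_norm// -normrZ -[s *: w](gF _ I) mapFE.
  by apply: cmax; rewrite inE; exact: fC.
have N1 : 0 < (N + 1) / `|w| by rewrite divr_gt0// ltr_wpDl// normr_ge0.
by have := sN _ N1; rewrite divfK ?gt_eqF// gerDl ler10.
Qed.

End Main.

Theorem theorem17 (R : realType) (l n m : nat)
    (A : 'M[R]_(l, m)) (B : 'M[R]_(n, m))
    (hC : coeff_cone A !=set0)
    (dP d : nat)
    (hdP : has_affine_dim (coeff_polytope A) dP)
    (hd : \dim (ker_ones B) = d)
    (hdd : dP = d)
    (nP : nat) (v : 'I_nP -> 'cV[R]_m)
    (hv_inj : injective v)
    (hv : range v = vertices (closure (coeff_polytope A)))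
    (G : 'M[R]_(m, dP))
    (hG_orth : G^T *m G = 1%:M)
    (hG_im : imv G = ker_ones A)
    (H : 'M[R]_(m, d))
    (hH : basis_of (ker_ones B) [seq col j H | j <- enum 'I_d]) :
  diffeomorphism [set: 'cV[R]_dP] (@posv R d) (mapF v G H) <->
  (~ (exists y t db : 'cV[R]_m,
        [/\ coeff_polytope A y, t \in ker_ones A /\ t != 0,
            orthv (ker_ones B) db & t = cmul y db])) /\
  (forall t : 'cV[R]_m, t \in ker_ones A -> t != 0 ->
     ~ orthv (ker_ones B) (mu_max v t)).
Proof.
subst dP.
have P0 : coeff_polytope A !=set0 by case: hdP => x [U [Px _ _]]; exists x.
have HP w : orthv (ker_ones B) w <-> H^T *m w = 0 := orthv_basis w hH.
have H1 : H^T *m const_mx 1 = 0 :> 'cV[R]_d.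
  by apply/HP => u /mem_ker_ones[_].
split=> [dF|[hi hii]].
  split; last by move=> t tT t0 /HP; exact: (diffeomorphism_mapF_mu_max hv P0 hG_im H1 dF).
  move=> [y [t [db [Py tT /HP Hdb tE]]]].
  by apply: (diffeomorphism_mapF_tangent hv P0 hG_orth hG_im H1 dF); exists y, t, db.
apply: (diffeomorphism_mapF hv P0 hG_orth hG_im H1).
  move=> [y [t [db [Py tT /HP Hdb tE]]]].
  by apply: hi; exists y, t, db.
by move=> t tT t0 /HP; exact: hii.
Qed.
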